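(* Balanced Cluster Editing admits an algorithm running in time $4^{k+o(k)}\cdot n^{\mathcal{O}(1)}$, where $n$ is the number of vertices of the input graph.
   Context: All graphs are finite and simple. A cluster graph is a graph in which every connected component is a clique. For a non-negative integer $\eta$, a graph is $\eta$-balanced if for any two connected components $H,H'$ we have $\big||V(H)|-|V(H')|\big|\le\eta$. Balanced Cluster Editing: given a graph $G$ and non-negative integers $k,\eta$, decide whether there is $F\subseteq\binom{V(G)}{2}$ with $|F|\le k$ such that the graph $(V(G),E(G)\triangle F)$ is an $\eta$-balanced cluster graph. *)

(* Defs.v *)
From HB Require Import structures.
From mathcomp Require Import all_boot all_order all_algebra.

Set Implicit Arguments.
Unset Strict Implicit.
Unset Printing Implicit Defensive.

(** A simple graph on [V] is given by its set of edges, a subset of [pairs V]. *)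

Section Graphs.
Variable V : finType.
Implicit Types (E F : {set {set V}}) (k eta : nat).

Definition pairs : {set {set V}} := [set A : {set V} | #|A| == 2].

Definition adj E : rel V := [rel x y | [set x; y] \in E].

Definition component E (x : V) : {set V} := [set y | connect (adj E) x y].

Definition components E : {set {set V}} := [set component E x | x : V].

Definition is_clique E (H : {set V}) : Prop :=
  forall x y : V, x \in H -> y \in H -> x != y -> adj E x y.

Definition cluster_graph E : Prop :=
  forall H, H \in components E -> is_clique E H.

Definition balanced eta E : Prop :=
  forall H H', H \in components E -> H' \in components E ->
    `| (#|H|%:Z - #|H'|%:Z)%R |%N <= eta.

Definition symdiff E F : {set {set V}} := (E :\: F) :|: (F :\: E).

Definition balanced_cluster_editing E k eta : Prop :=
  exists F : {set {set V}},
    [/\ F \subset pairs, #|F| <= k,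
        cluster_graph (symdiff E F) & balanced eta (symdiff E F)].

End Graphs.

Arguments pairs V : clear implicits.

(** Algorithms are random access machine programs in structured form.

    The memory consists of cells [X_0, X_1, ...] holding natural numbers, and
    every operation and every test has cost 1.  No operation increases the
    largest number in memory by more than 1 (or beyond a constant of the
    program), so after [t] steps the cells hold numbers of
    [O(log (t + largest input number))] bits: unit cost does not hide
    arithmetic on long numbers. *)

Definition memory := nat -> nat.

Definition upd (m : memory) (a v : nat) : memory :=
  fun x => if x == a then v else m x.

Inductive prog :=
| Skip
| Const of nat & nat
| Copy of nat & nat
| Succ of nat & nat
| Sub of nat & nat & nat
| Read of nat & nat
| Write of nat & nat
| Seq of prog & prog
| If of nat & prog & prog
| While of nat & prog.

(** [exec p m t m']: started on memory [m], program [p] halts after exactly [t]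
    steps with memory [m']. *)
Inductive exec : prog -> memory -> nat -> memory -> Prop :=
| exec_Skip m : exec Skip m 1 m
| exec_Const m a c : exec (Const a c) m 1 (upd m a c)
| exec_Copy m a b : exec (Copy a b) m 1 (upd m a (m b))
| exec_Succ m a b : exec (Succ a b) m 1 (upd m a (m b).+1)
| exec_Sub m a b c : exec (Sub a b c) m 1 (upd m a (m b - m c))
| exec_Read m a b : exec (Read a b) m 1 (upd m a (m (m b)))
| exec_Write m a b : exec (Write a b) m 1 (upd m (m a) (m b))
| exec_Seq p q m t m' t' m'' :
    exec p m t m' -> exec q m' t' m'' -> exec (Seq p q) m (t + t') m''
| exec_If_true a p q m t m' :
    m a != 0 -> exec p m t m' -> exec (If a p q) m t.+1 m'
| exec_If_false a p q m t m' :
    m a = 0 -> exec q m t m' -> exec (If a p q) m t.+1 m'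
| exec_While_true a p m t m' t' m'' :
    m a != 0 -> exec p m t m' -> exec (While a p) m' t' m'' ->
    exec (While a p) m (t + t').+1 m''
| exec_While_false a p m :
    m a = 0 -> exec (While a p) m 1 m.

(** The instance [(G, k, eta)] with [V(G) = {0, ..., n-1}] is written in memory
    as [n], [k], [eta], followed by the [n * n] adjacency matrix of [G] in
    row-major order; all further cells are 0. *)
Definition encode (n : nat) (E : {set {set 'I_n}}) (k eta : nat) : memory :=
  fun a =>
    if a == 0 then n
    else if a == 1 then k
    else if a == 2 then eta
    else [exists i : 'I_n, exists j : 'I_n, (a == 3 + (i * n + j)) && adj E i j].

Definition accepts (m : memory) : Prop := m 0 != 0.

(* Main.v *)
(** A run of the algorithm is driven by a string of [k] digits in [{0,1,2,3}];
    the machine tries all [4 ^ k] strings, each in polynomial time.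

    While the graph contains an induced path [u - v - w], every solution edits
    one of the pairs [uv], [vw], [uw], and one digit tells which.  On a cluster
    graph only the sizes of the cliques matter, and the distance between two
    cluster graphs is the length of a shortest path of splits and merges, where
    splitting a clique of size [p + q] into parts of sizes [p] and [q], or
    merging cliques of sizes [p] and [q], costs [p * q] edits.  Such a move is
    written with [p + q - 1 <= p * q] digits, so that solutions with at most [k]
    edits correspond to strings of length [k]. *)
Require Import Defs.
From HB Require Import structures.
From mathcomp Require Import all_boot all_order all_algebra.
From mathcomp Require Import zify.

Set Implicit Arguments.
Unset Strict Implicit.
Unset Printing Implicit Defensive.

(** * Running times of machine programs *)

(** Two facts make moves on bare sizes legitimate. A target clustering can be reached by moves that
    flip only pairs on which the current and the target clustering disagree, so the costs [p * q]
    add up to exactly the distance. Conversely, sizes forget which vertices lie together, but any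
    move that a profile of sizes permits can be carried out on every labelling with that profile and
    raises the edit cost by at most [p * q]; so an accepted string always comes from a real
    solution. Nothing bounds [k] in terms of [n], hence one string takes time polynomial in [n + k].
    The factor in [k], of the form [(A + 1) * (k + 1) ^ C], is written as [4 ^ g k] with [g]
    logarithmic: this is the whole of the o(k). The machine has only successor and truncated
    subtraction, so the algorithm is written in a language of bounded loops and compiled. Sums are
    cut off at a bound [cap] of order [n * n + k]; as [cap] exceeds [n] and [k], a cut-off occurs
    only in runs that are rejected anyway. *)

Definition runs (p : prog) (m : memory) (T : nat) (Q : memory -> Prop) : Prop :=
  exists t m', [/\ exec p m t m', t <= T & Q m'].

Lemma runs_weaken p m T T' (Q Q' : memory -> Prop) :
  runs p m T Q -> T <= T' -> (forall m', Q m' -> Q' m') -> runs p m T' Q'.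
Proof.
move=> [t [m' [ex le Qm]]] leT QQ; exists t, m'; split=> //; last exact: QQ.
exact: leq_trans leT.
Qed.

Lemma runs_seq p q m T T' Q :
  runs p m T (fun m' => runs q m' T' Q) -> runs (Seq p q) m (T + T') Q.
Proof.
move=> [t [m' [ex le [t' [m'' [ex' le' Qm]]]]]].
by exists (t + t'), m''; split=> //; [apply: exec_Seq ex ex' | exact: leq_add].
Qed.

Lemma runs_if a p q m T (Q : memory -> Prop) :
  (m a != 0 -> runs p m T Q) -> (m a = 0 -> runs q m T Q) ->
  runs (If a p q) m T.+1 Q.
Proof.
move=> Hp Hq; case: (eqVneq (m a) 0) => ma.
  have [t [m' [ex le Qm]]] := Hq ma; exists t.+1, m'; split=> //.
  exact: exec_If_false.
have [t [m' [ex le Qm]]] := Hp ma; exists t.+1, m'; split=> //.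
exact: exec_If_true.
Qed.

Lemma runs_while_iter a p T N (I : nat -> memory -> Prop) m :
  I 0 m ->
  (forall i m', i < N -> I i m' -> m' a != 0 /\ runs p m' T (I i.+1)) ->
  (forall m', I N m' -> m' a = 0) ->
  runs (While a p) m (N * T.+1).+1 (I N).
Proof.
move=> I0 IS IN.
suff H j m' : j <= N -> I (N - j) m' ->
    runs (While a p) m' (j * T.+1).+1 (I N).
  by apply: H; rewrite ?subnn.
elim: j m' => [|j IH] m' jN Im.
  rewrite subn0 in Im; exists 1, m'; split=> //.
  by apply: exec_While_false; apply: IN.
have [ma [t [m1 [ex le Im1]]]] := IS (N - j.+1) m' ltac:(lia) Im.
have [|t' [m2 [ex' le' Im2]]] := IH m1 (ltnW jN).
  by have -> : N - j = (N - j.+1).+1 by lia.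
exists (t + t').+1, m2; split=> //; last by lia.
exact: exec_While_true ma ex ex'.
Qed.

Ltac prim := eexists; eexists; split; [by constructor | by [] | idtac].
Lemma runs_Skip m (Q : memory -> Prop) : Q m -> runs Skip m 1 Q.
Proof. by move=> H; prim. Qed.
Lemma runs_Const m a c (Q : memory -> Prop) :
  Q (upd m a c) -> runs (Const a c) m 1 Q.
Proof. by move=> H; prim. Qed.
Lemma runs_Copy m a b (Q : memory -> Prop) :
  Q (upd m a (m b)) -> runs (Copy a b) m 1 Q.
Proof. by move=> H; prim. Qed.
Lemma runs_Succ m a b (Q : memory -> Prop) :
  Q (upd m a (m b).+1) -> runs (Succ a b) m 1 Q.
Proof. by move=> H; prim. Qed.
Lemma runs_Sub m a b c (Q : memory -> Prop) :
  Q (upd m a (m b - m c)) -> runs (Defs.Sub a b c) m 1 Q.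
Proof. by move=> H; prim. Qed.
Lemma runs_Read m a b (Q : memory -> Prop) :
  Q (upd m a (m (m b))) -> runs (Read a b) m 1 Q.
Proof. by move=> H; prim. Qed.
Lemma runs_Write m a b (Q : memory -> Prop) :
  Q (upd m (m a) (m b)) -> runs (Write a b) m 1 Q.
Proof. by move=> H; prim. Qed.

Lemma updE m a v : upd m a v a = v.
Proof. by rewrite /upd eqxx. Qed.

Lemma updNE m a v x : x != a -> upd m a v x = m x.
Proof. by rewrite /upd => /negbTE ->. Qed.

Ltac updlia := repeat first [rewrite updE | rewrite updNE; [|lia]].

(* [u] is a scratch cell: the machine can only subtract cells. *)
Definition Rep (c u : nat) (p : prog) : prog :=
  While c (Seq p (Seq (Const u 1) (Defs.Sub c c u))).

(** The invariant is required after the decrement, which overwrites [u] as well as [c]; the body may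
    use both [u] and the invariant's cells freely but must leave the counter [c] as it found it. *)
Lemma runs_rep c u p T N (I : nat -> memory -> Prop) m :
  c != u -> m c = N -> I 0 m ->
  (forall i m', i < N -> m' c = N - i -> I i m' ->
     runs p m' T (fun m'' =>
       m'' c = m' c /\ I i.+1 (upd (upd m'' u 1) c (m'' c - 1)))) ->
  runs (Rep c u p) m (N * (T + 3)).+1 (fun m' => m' c = 0 /\ I N m').
Proof.
move=> cu mc I0 IS.
pose J i m' := m' c = N - i /\ I i m'.
have H : runs (Rep c u p) m (N * (T + 2).+1).+1 (J N).
  apply: runs_while_iter => [|i m' iN [mi Ii]|m' [-> _]]; last by lia.
    by split=> //; rewrite mc subn0.
  split; first by lia.
  apply: runs_seq; apply: runs_weaken (IS i m' iN mi Ii) _ _ => // m1 [m1c Im].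
  apply: (runs_weaken (T := 1 + 1)) => //; last by move=> ? h; exact: h.
  apply: runs_seq; apply: runs_Const; apply: runs_Sub.
  rewrite updE updNE //; split=> //; rewrite updE; lia.
apply: runs_weaken H _ _; first by lia.
by move=> m' []; rewrite subnn.
Qed.

(** Addition of a constant known at compile time. Under [Rep] it yields [N * K], which is how
    addition and multiplication are obtained on a machine without them. *)
Definition Succs (r K : nat) : prog := iter K (Seq (Succ r r)) Skip.

Lemma runs_succs r K m :
  runs (Succs r K) m K.+1
    (fun m' => m' r = m r + K /\ forall y, y != r -> m' y = m y).
Proof.
elim: K m => [|K IH] m; first by apply: runs_Skip; split; rewrite ?addn0.
apply: (runs_weaken (T := 1 + K.+1)) => //; last by move=> ? h; exact: h.
apply: runs_seq; apply: runs_Succ; apply: runs_weaken (IH _) _ _ => // m' [e1 e2].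
split; first by rewrite e1 updE; lia.
by move=> y yr; rewrite e2 // updNE.
Qed.

Lemma runs_addloop c u r K N m :
  c != u -> c != r -> u != r -> m c = N ->
  runs (Rep c u (Succs r K)) m (N * (K + 4)).+1
    (fun m' => m' r = m r + N * K /\
               forall y, y != r -> y != c -> y != u -> m' y = m y).
Proof.
move=> cu cr ur mc.
apply: runs_weaken
  (@runs_rep c u (Succs r K) K.+1 N
     (fun i m' => m' r = m r + i * K /\
                  forall y, y != r -> y != c -> y != u -> m' y = m y)
     m cu mc _ _) _ _.
- by split=> //; lia.
- move=> i m' iN m'c [mr my].
  apply: runs_weaken (runs_succs r K m') _ _ => // m1 [m1r m1y].
  split; first by rewrite m1y.
  split; first by rewrite !updNE 1?eq_sym // m1r mr; lia.
  by move=> y yr yc yu; rewrite !updNE // m1y // my.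
- by lia.
- by move=> m' [_].
Qed.

(** * A language of bounded loops and its compiler *)

Inductive expr :=
| EC of nat
| EV of nat
| ECap
| EAdd of expr & expr
| ESub of expr & expr
| EGet of nat & expr & expr
| EIn of expr.

Inductive com :=
| CSkip
| CSet of nat & expr
| CPut of nat & expr & expr & expr
| CSeq of com & com
| CIf of expr & com & com
| CFor of nat & expr & com.

Record store := Store { vr : nat -> nat; ar : nat -> nat -> nat -> nat }.

(** Names are compared with [eqn], so that tests between concrete names compute away; array indices
    in [seta] are data and keep the generic equality. *)
Definition setv (s : store) x v : store :=
  Store (fun y => if eqn y x then v else vr s y) (ar s).

Definition seta (s : store) a i j v : store :=
  Store (vr s) (fun a' i' j' =>
    if [&& eqn a' a, i' == i & j' == j] then v else ar s a' i' j').

Section Compiler.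

(* Variables live in cells below [NV], the bound [cap] in cell [NV], temporaries
   in the cells up to [W].  The cells from [W] to [cap] still hold the input,
   and the [NA] two-dimensional arrays are interleaved from cell [cap] on. *)
Variables (NV NA W : nat).

Section Semantics.
Variables (cap : nat) (inp : nat -> nat).

(* Sums, array indices and loop bounds are truncated at [cap], so that every
   program is total and polynomial in [cap] regardless of the data. *)
Fixpoint eval (s : store) (e : expr) : nat :=
  match e with
  | EC c => c
  | EV x => vr s x
  | ECap => cap
  | EAdd e1 e2 => minn (eval s e1 + eval s e2) cap
  | ESub e1 e2 => eval s e1 - eval s e2
  | EGet a e1 e2 => ar s a (minn (eval s e1) cap) (minn (eval s e2) cap)
  | EIn e => if (W <= eval s e) && (eval s e < cap) then inp (eval s e) else 0
  end.

Fixpoint run (c : com) (s : store) : store :=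
  match c with
  | CSkip => s
  | CSet x e => setv s x (eval s e)
  | CPut a e1 e2 e3 =>
      seta s a (minn (eval s e1) cap) (minn (eval s e2) cap) (eval s e3)
  | CSeq c1 c2 => run c2 (run c1 s)
  | CIf e c1 c2 => if eval s e == 0 then run c2 s else run c1 s
  | CFor x e c =>
      iteri (minn (eval s e) cap) (fun i s' => run c (setv s' x i)) s
  end.

Definition represents (s : store) (m : memory) : Prop :=
  [/\ forall x, x < NV -> m x = vr s x,
      m NV = cap,
      forall a i j, a < NA -> i <= cap -> j <= cap ->
        m (cap + (i * cap.+1 + j) * NA + a) = ar s a i j
    & forall y, W <= y < cap -> m y = inp y].

End Semantics.

(** With truncated subtraction, [cap - (cap - x)] is the minimum of [x] and [cap]. *)
Definition Trunc d : prog := Seq (Defs.Sub d NV d) (Defs.Sub d NV d).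

(** The indices are in [d] and [d.+1], the address grows in [d.+2] from [cap]: the outer loop adds
    [NA] in [cap.+1] rounds for each unit of the first index, the next loop adds [NA] for each unit
    of the second. *)
Definition Addr d a : prog :=
  Seq (Trunc d) (Seq (Trunc d.+1) (Seq (Copy d.+2 NV)
   (Seq (Rep d d.+4 (Seq (Succ d.+3 NV) (Rep d.+3 d.+4 (Succs d.+2 NA))))
   (Seq (Rep d.+1 d.+4 (Succs d.+2 NA)) (Succs d.+2 a))))).

(** The value ends up in cell [d], cells above it are scratch. The capped sum of [x] and [y] is
    computed as [cap - ((cap - x) - y)]. *)
Fixpoint ce d e : prog :=
  match e with
  | EC c => Const d c
  | EV x => Copy d x
  | ECap => Copy d NV
  | EAdd e1 e2 => Seq (ce d e1) (Seq (ce d.+1 e2)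
      (Seq (Defs.Sub d NV d) (Seq (Defs.Sub d d d.+1) (Defs.Sub d NV d))))
  | ESub e1 e2 => Seq (ce d e1) (Seq (ce d.+1 e2) (Defs.Sub d d d.+1))
  | EGet a e1 e2 => Seq (ce d e1) (Seq (ce d.+1 e2)
      (Seq (Addr d a) (Read d d.+2)))
  | EIn e => Seq (ce d e) (Seq (Const d.+1 W) (Seq (Defs.Sub d.+1 d.+1 d)
      (If d.+1 (Const d 0)
        (Seq (Defs.Sub d.+1 NV d) (If d.+1 (Read d d) (Const d 0))))))
  end.

(** A loop keeps its remaining rounds in [d] and its index in [d.+1], apart from the variable [x],
    so the body may assign to [x]. Cell [d.+2] is shared by the body and by the decrement of [Rep],
    which writes it only after the body. *)
Fixpoint cc d c : prog :=
  match c with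
  | CSkip => Skip
  | CSet x e => Seq (ce d e) (Copy x d)
  | CPut a e1 e2 e3 => Seq (ce d e3) (Seq (ce d.+1 e1) (Seq (ce d.+2 e2)
      (Seq (Addr d.+1 a) (Write d.+3 d))))
  | CSeq c1 c2 => Seq (cc d c1) (cc d c2)
  | CIf e c1 c2 => Seq (ce d e) (If d (cc d c1) (cc d c2))
  | CFor x e c => Seq (ce d e) (Seq (Trunc d) (Seq (Const d.+1 0)
      (Rep d d.+2 (Seq (Copy x d.+1) (Seq (cc d.+2 c) (Succ d.+1 d.+1))))))
  end.

Fixpoint wfe d e : bool :=
  match e with
  | EC _ | ECap => d < W
  | EV x => (d < W) && (x < NV)
  | EAdd e1 e2 | ESub e1 e2 => wfe d e1 && wfe d.+1 e2
  | EGet a e1 e2 => [&& d.+4 < W, a < NA, wfe d e1 & wfe d.+1 e2]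
  | EIn e => (d.+1 < W) && wfe d e
  end.

Fixpoint wfc d c : bool :=
  match c with
  | CSkip => true
  | CSet x e => (x < NV) && wfe d e
  | CPut a e1 e2 e3 =>
      [&& d.+4.+1 < W, a < NA, wfe d e3, wfe d.+1 e1 & wfe d.+2 e2]
  | CSeq c1 c2 => wfc d c1 && wfc d c2
  | CIf e c1 c2 => [&& wfe d e, wfc d c1 & wfc d c2]
  | CFor x e c => [&& d.+2 < W, x < NV, wfe d e & wfc d.+2 c]
  end.

Section Bounds.
Variable cap : nat.

Definition tAddr a : nat :=
  5 + (cap * (2 + cap.+1 * (NA + 4) + 3)).+1 + (cap * (NA + 4)).+1 + a.+1.

Fixpoint te e : nat :=
  match e with
  | EC _ | EV _ | ECap => 1
  | EAdd e1 e2 => te e1 + (te e2 + 3)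
  | ESub e1 e2 => te e1 + (te e2 + 1)
  | EGet a e1 e2 => te e1 + (te e2 + (tAddr a + 1))
  | EIn e => te e + 6
  end.

Fixpoint tc c : nat :=
  match c with
  | CSkip => 1
  | CSet x e => te e + 1
  | CPut a e1 e2 e3 => te e3 + (te e1 + (te e2 + (tAddr a + 1)))
  | CSeq c1 c2 => tc c1 + tc c2
  | CIf e c1 c2 => te e + (tc c1 + tc c2).+1
  | CFor x e c => te e + (3 + (cap * (tc c + 5)).+1)
  end.

End Bounds.

Section Correctness.
Variables (cap : nat) (inp : nat -> nat).
Hypothesis NVW : NV < W.
Hypothesis Wcap : W <= cap.

Definition off d (m m' : memory) : Prop :=
  forall y, (y < d) || (W <= y) -> m' y = m y.

Lemma off_trans d d' m1 m2 m3 :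
  d <= d' -> off d m1 m2 -> off d' m2 m3 -> off d m1 m3.
Proof. by move=> dd o1 o2 y h; rewrite o2 ?o1 //; lia. Qed.

Lemma off_upd d d' m m' v :
  off d m m' -> d <= d' < W -> off d m (upd m' d' v).
Proof. by move=> o1 dd y h; rewrite updNE ?o1 //; lia. Qed.

Lemma represents_off d s m m' :
  NV < d -> represents cap inp s m -> off d m m' -> represents cap inp s m'.
Proof.
move=> dd [r1 r2 r3 r4] o; split.
- by move=> x xn; rewrite o ?r1 //; lia.
- by rewrite o //; lia.
- by move=> a i j aN iN jN; rewrite o ?r3 //; lia.
- by move=> y yW; rewrite o ?r4 //; lia.
Qed.

Lemma runs_trunc d m : NV < d < W -> m NV = cap ->
  runs (Trunc d) m 2 (fun m' => m' d = minn (m d) cap /\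
    forall y, y != d -> m' y = m y).
Proof.
move=> dd mN; apply: (@runs_seq _ _ _ 1 1).
apply: runs_Sub; apply: runs_Sub; split.
  by updlia; rewrite mN; lia.
by move=> y yd; rewrite !updNE.
Qed.

Lemma runs_addr d a m i j : NV < d -> d.+4 < W -> m NV = cap ->
  m d = i -> m d.+1 = j ->
  runs (Addr d a) m (tAddr cap a) (fun m' =>
    m' d.+2 = cap + (minn i cap * cap.+1 + minn j cap) * NA + a /\
    off d m m').
Proof.
move=> dN dW mN mi mj.
apply: (runs_weaken (T := 2 + (2 + (1 + ((cap * (2 + cap.+1 * (NA + 4) + 3)).+1 +
  ((cap * (NA + 4)).+1 + a.+1)))))); [|by rewrite /tAddr; lia|by move=> ? h; exact: h].
apply: runs_seq; apply: runs_weaken (runs_trunc _ mN) _ _ => //; first by lia.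
move=> m1 [m1d m1o].
apply: runs_seq; apply: runs_weaken (runs_trunc (d := d.+1) _ _) _ _ => //;
  [lia|by rewrite m1o //; lia|].
move=> m2 [m2d m2o].
apply: runs_seq; apply: runs_Copy; set m3 := upd _ _ _.
set i' := minn i cap; set j' := minn j cap.
have m3d : m3 d = i' by rewrite /m3 updNE ?m2o ?m1d ?mi //; lia.
have m3d1 : m3 d.+1 = j' by rewrite /m3 updNE ?m2d ?m1o ?mj //; lia.
have m3d2 : m3 d.+2 = cap by rewrite /m3 updE ?m2o ?m1o ?mN //; lia.
have m3o : off d m m3.
  by move=> y h; rewrite /m3 updNE ?m2o ?m1o //; lia.
clearbody m3; clear m1 m2 m1d m1o m2d m2o.
apply: runs_seq.
pose I t (m' : memory) := [/\ m' d.+2 = cap + t * (cap.+1 * NA), m' d.+1 = j'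
  & off d m m'].
apply: runs_weaken (runs_rep (T := 2 + cap.+1 * (NA + 4)) (I := I) _ m3d _ _) _ _.
- by lia.
- by split=> //; rewrite m3d2; lia.
- move=> t m' ti m'd [I1 I2 I3].
  apply: (runs_weaken (T := 1 + (cap.+1 * (NA + 4)).+1)); [|by lia|by move=> ? h; exact: h].
  apply: runs_seq; apply: runs_Succ.
  have mNV : m' NV = cap by rewrite I3 ?mN //; lia.
  apply: runs_weaken (runs_addloop (N := cap.+1) _ _ _ _ _) _ _; try lia.
    by rewrite updE mNV.
  move=> m4 [m4d m4o]; split.
    by rewrite m4o ?updNE //; lia.
  split.
  + by rewrite !updNE ?m4d ?updNE ?I1 //; lia.
  + by rewrite !updNE ?m4o ?updNE ?I2 //; lia.
  + by move=> y h; rewrite !updNE ?m4o ?updNE ?I3 //; lia.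
- rewrite ltnS leq_mul2r; apply/orP; right; rewrite /i'; lia.
move=> m4 [_ [m4a m4b m4o]].
apply: runs_seq.
apply: runs_weaken (runs_addloop (N := j') _ _ _ _ m4b) _ _; try lia.
  by rewrite ltnS leq_mul2r /j'; apply/orP; right; lia.
move=> m5 [m5d m5o].
apply: runs_weaken (runs_succs _ _ _) _ _ => // m6 [m6d m6o]; split.
  by rewrite m6d m5d m4a; lia.
by move=> y h; rewrite m6o ?m5o ?m4o //; lia.
Qed.

Lemma wfe_lt e d : wfe d e -> d < W.
Proof.
elim: e d => [c|x||e1 IH1 e2 IH2|e1 IH1 e2 IH2|a e1 IH1 e2 IH2|e IH] d //=.
- by case/andP.
- by case/andP=> /IH1.
- by case/andP=> /IH1.
- by case/and4P=> _ _ /IH1.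
- by case/andP=> _ /IH.
Qed.

Lemma runs_ce e d s m :
  NV < d -> wfe d e -> represents cap inp s m ->
  runs (ce d e) m (te cap e) (fun m' => m' d = eval cap inp s e /\ off d m m').
Proof.
elim: e d m => [c|x||e1 IH1 e2 IH2|e1 IH1 e2 IH2|a e1 IH1 e2 IH2|e IH] d m dN /=.
- by move=> dW r; apply: runs_Const; rewrite updE; split=> //; apply: off_upd => //; lia.
- move=> /andP[dW xN] r; apply: runs_Copy; rewrite updE; split; last by apply: off_upd => //; lia.
  by case: r => r1 _ _ _; apply: r1.
- move=> dW r; apply: runs_Copy; rewrite updE; split; last by apply: off_upd => //; lia.
  by case: r.
- move=> /andP[w1 w2] r.
  apply: runs_seq; apply: runs_weaken (IH1 d m dN w1 r) _ _ => // m1 [m1d m1o].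
  have r1 := represents_off dN r m1o.
  apply: runs_seq; apply: runs_weaken (IH2 d.+1 m1 _ w2 r1) _ _ => //; first lia.
  move=> m2 [m2d m2o].
  have [_ m2N _ _] := represents_off (d := d.+1) (leqW dN) r1 m2o.
  have dW := wfe_lt w2.
  apply: (runs_weaken (T := 1 + (1 + 1))) => //; last by move=> ? h; exact: h.
  apply: runs_seq; apply: runs_Sub; apply: runs_seq; apply: runs_Sub; apply: runs_Sub.
  updlia; rewrite m2N m2d m2o ?m1d; last lia.
  split; first by lia.
  do !(apply: off_upd; last by lia).
  exact: off_trans m1o m2o.
- move=> /andP[w1 w2] r.
  apply: runs_seq; apply: runs_weaken (IH1 d m dN w1 r) _ _ => // m1 [m1d m1o].
  have r1 := represents_off dN r m1o.
  apply: runs_seq; apply: runs_weaken (IH2 d.+1 m1 _ w2 r1) _ _ => //; first lia.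
  move=> m2 [m2d m2o].
  have dW := wfe_lt w2.
  apply: runs_Sub.
  updlia; rewrite m2d m2o ?m1d; last lia.
  split=> //; apply: off_upd; last by lia.
  exact: off_trans m1o m2o.
- move=> /and4P[dW aN w1 w2] r.
  apply: runs_seq; apply: runs_weaken (IH1 d m dN w1 r) _ _ => // m1 [m1d m1o].
  have r1 := represents_off dN r m1o.
  apply: runs_seq; apply: runs_weaken (IH2 d.+1 m1 _ w2 r1) _ _ => //; first lia.
  move=> m2 [m2d m2o].
  have r2 := represents_off (d := d.+1) (leqW dN) r1 m2o.
  have [_ m2N _ _] := r2.
  apply: runs_seq.
  apply: runs_weaken (runs_addr a dN dW m2N (i := eval cap inp s e1) _ m2d) _ _ => //.
    by rewrite m2o ?m1d //; lia.
  move=> m3 [m3d m3o]; apply: runs_Read.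
  have [_ _ r3 _] := represents_off dN r2 m3o.
  rewrite updE m3d r3 //; try lia.
  split=> //; apply: off_upd; last by lia.
  by apply: off_trans m3o => //; apply: off_trans m2o.
- move=> /andP[dW w] r.
  apply: runs_seq; apply: runs_weaken (IH d m dN w r) _ _ => // m1 [m1d m1o].
  have [_ r2 _ r4] := represents_off dN r m1o.
  apply: (runs_weaken (T := 1 + (1 + (1 + 2).+1))) => //; last by move=> ? h; exact: h.
  apply: runs_seq; apply: runs_Const; apply: runs_seq; apply: runs_Sub; updlia.
  apply: runs_if; updlia; rewrite m1d => h.
    apply: (runs_weaken (T := 1)) => //; last by move=> ? h'; exact: h'.
    apply: runs_Const; updlia; rewrite leqNgt (_ : _ < W); last lia.
    by split=> //; do !(apply: off_upd; last by lia).
  rewrite (_ : W <= _) /=; last lia.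
  apply: (runs_weaken (T := 1 + 1.+1)) => //; last by move=> ? h'; exact: h'.
  apply: runs_seq; apply: runs_Sub; apply: runs_if; updlia; rewrite r2 m1d => h'.
    have md v1 v2 v3 : upd (upd (upd m1 d.+1 v1) d.+1 v2) d.+1 v3 d = eval cap inp s e.
      by updlia.
    apply: runs_Read; rewrite updE !md.
    rewrite !updNE ?r4; try lia.
    rewrite (_ : _ < cap); last lia.
    by split=> //; do !(apply: off_upd; last by lia).
  apply: runs_Const; updlia; rewrite ltnNge (_ : cap <= _); last lia.
  by split=> //; do !(apply: off_upd; last by lia).
Qed.

Lemma represents_setv s m x v : x < NV ->
  represents cap inp s m -> represents cap inp (setv s x v) (upd m x v).
Proof.
move=> xN [r1 r2 r3 r4]; split.
- by move=> y yN; rewrite /upd /= -[eqn y x]/(y == x); case: eqP => // _; apply: r1.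
- by rewrite updNE //; lia.
- by move=> a i j aN iN jN; rewrite updNE ?r3 //; lia.
- by move=> y yW; rewrite updNE ?r4 //; lia.
Qed.

(** Uniqueness of a mixed radix expansion: [a] is the residue modulo [NA], and [j] the residue of
    the quotient modulo [cap.+1]. *)
Lemma addr_inj i j a i' j' a' : a < NA -> a' < NA -> j <= cap -> j' <= cap ->
  (i * cap.+1 + j) * NA + a = (i' * cap.+1 + j') * NA + a' ->
  [/\ a = a', i = i' & j = j'].
Proof.
move=> aN aN' jc jc' e.
have aa : a = a'.
  have := congr1 (fun x => x %% NA) e.
  by rewrite !modnMDl !modn_small.
have [e2] : i * cap.+1 + j = i' * cap.+1 + j'.
  have := congr1 (fun x => x %/ NA) e.
  by rewrite !divnMDl ?divn_small ?addn0 //; lia.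
have jj : j = j'.
  have := congr1 (fun x => x %% cap.+1) e2.
  by rewrite !modnMDl !modn_small.
split=> //.
have := congr1 (fun x => x %/ cap.+1) e2.
by rewrite !divnMDl ?divn_small ?addn0 //; lia.
Qed.

Lemma represents_seta s m a i j v : a < NA -> i <= cap -> j <= cap ->
  represents cap inp s m ->
  represents cap inp (seta s a i j v) (upd m (cap + (i * cap.+1 + j) * NA + a) v).
Proof.
move=> aN iN jN [r1 r2 r3 r4]; split.
- by move=> y yN; rewrite updNE ?r1 //; lia.
- by rewrite updNE //; lia.
- move=> a' i' j' aN' iN' jN'; rewrite /upd /= -[eqn _ _]/(_ == _).
  case: ifP => [/eqP e|ne].
    have [-> -> ->] : [/\ a' = a, i' = i & j' = j] by apply: addr_inj => //; lia.
    by rewrite !eqxx.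
  case: ifP => [/and3P[/eqP ea /eqP ei /eqP ej]|_]; last exact: r3.
  by rewrite ea ei ej eqxx in ne.
- by move=> y yW; rewrite updNE ?r4 //; lia.
Qed.

(** Unlike an expression, a command changes variables and arrays; what survives is the bound in cell
    [NV] and the temporaries below [d], among them the counters of the enclosing loops. *)
Definition keeps d (m m' : memory) := forall y, NV <= y < d -> m' y = m y.

Lemma runs_cc c d s m :
  NV < d -> wfc d c -> represents cap inp s m ->
  runs (cc d c) m (tc cap c)
    (fun m' => represents cap inp (run cap inp c s) m' /\ keeps d m m').
Proof.
elim: c d s m => [|x e|a e1 e2 e3|c1 IH1 c2 IH2|e c1 IH1 c2 IH2|x e c IH] d s m dN /=.
- by move=> _ r; apply: runs_Skip.
- move=> /andP[xN w] r.
  apply: runs_seq; apply: runs_weaken (runs_ce dN w r) _ _ => // m1 [m1d m1o].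
  apply: runs_Copy; rewrite m1d; split.
    by apply: represents_setv => //; apply: represents_off m1o.
  by move=> y h; rewrite updNE ?m1o //; lia.
- move=> /and5P[dW aN w3 w1 w2] r.
  apply: runs_seq; apply: runs_weaken (runs_ce dN w3 r) _ _ => // m1 [m1d m1o].
  have r1 := represents_off dN r m1o.
  apply: runs_seq; apply: runs_weaken (runs_ce (d := d.+1) _ w1 r1) _ _ => //; first lia.
  move=> m2 [m2d m2o].
  have r2 := represents_off (d := d.+1) (leqW dN) r1 m2o.
  apply: runs_seq; apply: runs_weaken (runs_ce (d := d.+2) _ w2 r2) _ _ => //; first lia.
  move=> m3 [m3d m3o].
  have r3 := represents_off (d := d.+2) (leqW (leqW dN)) r2 m3o.
  have [_ m3N _ _] := r3.
  apply: runs_seq.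
  apply: runs_weaken (runs_addr (d := d.+1) a _ _ m3N
    (i := eval cap inp s e1) _ m3d) _ _ => //; first lia.
    by rewrite m3o ?m2d //; lia.
  move=> m4 [m4d m4o]; apply: runs_Write.
  have r4 := represents_off (d := d.+1) (leqW dN) r3 m4o.
  rewrite m4d (_ : m4 d = eval cap inp s e3); last first.
    by rewrite m4o ?m3o ?m2o ?m1d //; lia.
  split; first by apply: represents_seta => //; lia.
  by move=> y h; rewrite updNE ?m4o ?m3o ?m2o ?m1o //; lia.
- move=> /andP[w1 w2] r.
  apply: runs_seq; apply: runs_weaken (IH1 d s m dN w1 r) _ _ => // m1 [r1 o1].
  apply: runs_weaken (IH2 d _ m1 dN w2 r1) _ _ => // m2 [r2 o2]; split=> //.
  by move=> y h; rewrite o2 ?o1.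
- move=> /and3P[w w1 w2] r.
  apply: runs_seq; apply: runs_weaken (runs_ce dN w r) _ _ => // m1 [m1d m1o].
  have r1 := represents_off dN r m1o.
  have k1 : keeps d m m1 by move=> y h; rewrite m1o //; lia.
  apply: runs_if; rewrite m1d.
    move=> /negbTE ->; apply: runs_weaken (IH1 d s m1 dN w1 r1) _ _; first lia.
    by move=> m2 [r2 k2]; split=> // y h; rewrite k2 ?k1.
  move=> ->; rewrite eqxx; apply: runs_weaken (IH2 d s m1 dN w2 r1) _ _; first lia.
  by move=> m2 [r2 k2]; split=> // y h; rewrite k2 ?k1.
- move=> /and4P[dW xN w wc] r.
  apply: runs_seq; apply: runs_weaken (runs_ce dN w r) _ _ => // m1 [m1d m1o].
  set E := eval cap inp s e in m1d *; set N := minn E cap.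
  have r1 := represents_off dN r m1o.
  apply: (runs_weaken (T := 2 + (1 + (cap * (tc cap c + 2 + 3)).+1)));
    [|lia|by move=> ? h; exact: h].
  apply: runs_seq; apply: runs_weaken (runs_trunc (d := d) _ _) _ _ => //;
    [by lia|by case: r1|].
  move=> m2 [m2d m2o]; rewrite m1d -/N in m2d.
  have o2 : off d m1 m2 by move=> y h; rewrite m2o //; lia.
  apply: runs_seq; apply: runs_Const; set m3 := upd m2 _ _.
  have o3 : off d m1 m3 by apply: off_upd => //; lia.
  have r3 := represents_off dN r1 o3.
  pose I i (m' : memory) := [/\ m' d.+1 = i,
    represents cap inp (iteri i (fun i s' => run cap inp c (setv s' x i)) s) m'
    & keeps d m m'].
  apply: runs_weaken (runs_rep (T := tc cap c + 2) (I := I) (N := N) _ _ _ _) _ _.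
  + by lia.
  + by rewrite /m3 updNE //; lia.
  + split=> //; first by rewrite /m3 updE.
    by move=> y h; rewrite o3 ?m1o //; lia.
  + move=> i m' iN m'd [I1 I2 I3].
    apply: (runs_weaken (T := 1 + (tc cap c + 1))); [|by lia|by move=> ? h; exact: h].
    apply: runs_seq; apply: runs_Copy; rewrite I1.
    apply: runs_seq; apply: runs_weaken (IH d.+2 _ _ _ wc (represents_setv i xN I2)) _ _ => //.
      by lia.
    move=> m4 [r4 k4]; apply: runs_Succ.
    rewrite updNE; last lia.
    rewrite (k4 d) ?updNE; try lia.
    split=> //; split.
    * by updlia; rewrite k4; [updlia; rewrite I1|lia].
    * rewrite iteriS.
      apply: represents_off (d) _ _ _ dN r4 _.
      by move=> y h; rewrite !updNE //; lia.
    * by move=> y h; rewrite !updNE ?k4 ?updNE ?I3 //; lia.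
  + rewrite ltnS leq_mul2r; apply/orP; right; lia.
  + by move=> m4 [_ []].
Qed.

End Correctness.
End Compiler.

(** * Polynomial bounds on running times *)

Definition pbnd (C x : nat) : nat := C * x.+1 ^ C.

(** A single constant serves as coefficient and as exponent, so adding the constants is enough for a
    sum. The tactic [pb] can then build the constant while it walks through the bound. *)
Lemma pbnd_add a b C C' x :
  a <= pbnd C x -> b <= pbnd C' x -> a + b <= pbnd (C + C') x.
Proof.
move=> ha hb; rewrite /pbnd mulnDl; apply: leq_add.
  by apply: leq_trans ha _; rewrite leq_mul2l leq_pexp2l ?orbT ?leq_addr.
by apply: leq_trans hb _; rewrite leq_mul2l leq_pexp2l ?orbT ?leq_addl.
Qed.

Lemma pbnd_mulS a b C x : a <= x.+1 -> b <= pbnd C x -> a * b <= pbnd C.+1 x.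
Proof.
move=> ha hb; apply: leq_trans (leq_mul ha hb) _.
by rewrite /pbnd mulnCA -expnS leq_mul2r leqnSn orbT.
Qed.

Lemma pbnd_const c x : c <= pbnd c x.
Proof. by rewrite /pbnd leq_pmulr // expn_gt0. Qed.

Ltac pb := lazymatch goal with
  | |- is_true (_ + _ <= _) => apply: pbnd_add; pb
  | |- is_true (_ * _ <= _) => apply: pbnd_mulS; [lia | pb]
  | H : forall c, is_true (tAddr ?N c ?a <= _)
    |- is_true (tAddr ?N _ ?a <= _) => exact: H
  | H : forall c, is_true (te ?N c ?a <= _) |- is_true (te ?N _ ?a <= _) => exact: H
  | H : forall c, is_true (tc ?N c ?a <= _) |- is_true (tc ?N _ ?a <= _) => exact: H
  | |- is_true (?c <= _) => exact: (pbnd_const c)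
  end.

Lemma tAddr_poly NA a : exists C, forall cap, tAddr NA cap a <= pbnd C cap.
Proof.
eexists => cap; rewrite (_ : tAddr NA cap a = (8 + a) +
  cap * (5 + cap.+1 * (NA + 4)) + cap * (NA + 4)); last by rewrite /tAddr; lia.
pb.
Qed.

Lemma te_poly NA e : exists C, forall cap, te NA cap e <= pbnd C cap.
Proof.
elim: e => [c|x||e1 [C1 h1] e2 [C2 h2]|e1 [C1 h1] e2 [C2 h2]|a e1 [C1 h1] e2 [C2 h2]|e [C h]].
- by exists 1 => cap; apply: pbnd_const.
- by exists 1 => cap; apply: pbnd_const.
- by exists 1 => cap; apply: pbnd_const.
- by eexists => cap /=; pb.
- by eexists => cap /=; pb.
- have [C h] := tAddr_poly NA a.
  by eexists => cap /=; pb.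
- by eexists => cap /=; pb.
Qed.

Lemma tc_poly NA c : exists C, forall cap, tc NA cap c <= pbnd C cap.
Proof.
elim: c => [|x e|a e1 e2 e3|c1 [C1 h1] c2 [C2 h2]|e c1 [C1 h1] c2 [C2 h2]|x e c [C1 h1]].
- by exists 1 => cap; apply: pbnd_const.
- have [C h] := te_poly NA e.
  by eexists => cap /=; pb.
- have [C h] := tAddr_poly NA a.
  have [C1 h1] := te_poly NA e1; have [C2 h2] := te_poly NA e2.
  have [C3 h3] := te_poly NA e3.
  by eexists => cap /=; pb.
- by eexists => cap /=; pb.
- have [C h] := te_poly NA e.
  by eexists => cap /=; rewrite -[(_ + _).+1]addn1;
   pb.
- have [C h] := te_poly NA e.
  by eexists => cap /=; rewrite -[(_ * _).+1]addn1; pb.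
Qed.

(** * Frames and the invariant rule for loops *)

Fixpoint wvars c : seq nat :=
  match c with
  | CSkip | CPut _ _ _ _ => [::]
  | CSet x _ => [:: x]
  | CSeq c1 c2 | CIf _ c1 c2 => wvars c1 ++ wvars c2
  | CFor x _ c => x :: wvars c
  end.

Fixpoint warrs c : seq nat :=
  match c with
  | CSkip | CSet _ _ => [::]
  | CPut a _ _ _ => [:: a]
  | CSeq c1 c2 | CIf _ c1 c2 => warrs c1 ++ warrs c2
  | CFor _ _ c => warrs c
  end.

Definition frame c (s s' : store) : Prop :=
  (forall x, x \notin wvars c -> vr s' x = vr s x) /\
  (forall a i j, a \notin warrs c -> ar s' a i j = ar s a i j).

Section Frames.
Variables (W cap : nat) (inp : nat -> nat).
Notation run := (run W cap inp).
Notation eval := (eval W cap inp).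

Lemma frame_run c s : frame c s (run c s).
Proof.
elim: c s => [|x e|a e1 e2 e3|c1 IH1 c2 IH2|e c1 IH1 c2 IH2|x e c IH] s //=.
- split=> // y; rewrite /= inE -[eqn y x]/(y == x) => yx.
  by rewrite (negbTE yx).
- split=> // a' i j; rewrite /= inE -[eqn _ _]/(a' == a) => yx.
  by rewrite (negbTE yx).
- have [v1 a1] := IH1 s; have [v2 a2] := IH2 (run c1 s); split=> [y|a i j] /=;
    rewrite mem_cat negb_or => /andP[h1 h2]; rewrite ?v2 ?v1 ?a2 ?a1 //.
- have [v1 a1] := IH1 s; have [v2 a2] := IH2 s; split=> [y|a i j] /=;
    rewrite mem_cat negb_or => /andP[h1 h2]; case: ifP => _; rewrite ?v2 ?v1 ?a2 ?a1 //.
- elim: (minn _ _) => [//|N [v1 a1]]; rewrite iteriS.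
  have [v2 a2] := IH (setv (iteri N (fun i s' => run c (setv s' x i)) s) x N).
  split=> [y|a i j]; rewrite /= ?inE.
    rewrite negb_or => /andP[h1 h2]; rewrite v2 //= -[eqn y x]/(y == x) (negbTE h1) v1 //.
    by rewrite /= inE negb_or h1.
  by move=> h; rewrite a2 //= a1.
Qed.

(** Each round receives, besides the invariant, a frame from the initial store; invariants therefore
    need not mention data that the loop never writes. *)
Lemma run_for x e c s N (I : nat -> store -> Prop) :
  minn (eval s e) cap = N -> I 0 s ->
  (forall i s', i < N -> frame (CFor x e c) s s' -> I i s' ->
    I i.+1 (run c (setv s' x i))) ->
  I N (run (CFor x e c) s).
Proof.
move=> {N}<- I0 IS /=.
suff: forall N, N <= minn (eval s e) cap ->
   frame (CFor x e c) s (iteri N (fun i s' => run c (setv s' x i)) s) /\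
   I N (iteri N (fun i s' => run c (setv s' x i)) s).
  by move=> h; have [] := h _ (leqnn _).
elim=> [|N IH] leN; first by split.
have [[fv fa] IN] := IH (ltnW leN); rewrite iteriS.
split; last by apply: IS.
have [v2 a2] := frame_run c (setv (iteri N (fun i s' => run c (setv s' x i)) s) x N).
split=> [y yx|a i j ac]; last by rewrite a2 //= fa.
have := yx; rewrite /= inE negb_or => /andP[yx' yc].
by rewrite v2 //= -[eqn y x]/(y == x) (negbTE yx') fv.
Qed.

End Frames.

(* The machine has no free fixed cells besides the matrix: the bits in the first
   cells are remembered in the control state while these cells are reused. *)
Fixpoint Branch (b a : nat) (acc : seq nat) (K : seq nat -> prog) : prog :=
  if b is b'.+1 then
    If a (Branch b' a.+1 (rcons acc 1) K) (Branch b' a.+1 (rcons acc 0) K)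
  else K acc.

Lemma runs_branch b a acc K m T Q :
  (forall y, a <= y < a + b -> m y <= 1) ->
  runs (K (acc ++ [seq m y | y <- iota a b])) m T Q ->
  runs (Branch b a acc K) m (T + b) Q.
Proof.
elim: b a acc => [|b IH] a acc mb /=; first by rewrite cats0 addn0.
rewrite -cat_rcons addnS => h.
have mb' y : a.+1 <= y < a.+1 + b -> m y <= 1 by move=> hy; apply: mb; lia.
have ma : m a <= 1 by apply: mb; lia.
apply: runs_if => e; apply: IH => //.
  by have <- : m a = 1 by lia.
by rewrite -e.
Qed.

(** * Labellings, splits and merges *)

Section Labellings.
Variable n : nat.
Implicit Types (f g h : nat -> nat) (a : nat -> nat -> bool).

(* A cluster graph on [0, ..., n-1] is given by a labelling of the vertices whose
   fibres are the cliques.  Edits are counted over ordered pairs, hence twice. *)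
Definition dist f g : nat :=
  \sum_(i < n) \sum_(j < n) ((f i == f j) (+) (g i == g j)).

Definition ecost a f : nat :=
  \sum_(i < n) \sum_(j < n) ((i != j :> nat) && (a i j (+) (f i == f j))).

Definition fib f z : nat := \sum_(i < n) (f i == z).

Definition bsize f i : nat := fib f (f i).

(** Vertices are counted rather than cliques, so the value is [s] times the number of cliques of
    size [s]. This can be read off the degrees without identifying any clique. *)
Definition prof f s : nat := \sum_(i < n) (bsize f i == s).

Lemma sum_prod (A B : nat -> bool) :
  \sum_(i < n) \sum_(j < n) (A i && B j) =
  (\sum_(i < n) A i) * (\sum_(j < n) B j).
Proof.
rewrite big_distrlr /=; apply: eq_bigr => i _; apply: eq_bigr => j _.
by case: (A i); case: (B j).
Qed.

Lemma sum_cross (A B : nat -> bool) :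
  \sum_(i < n) \sum_(j < n) ((A i && B j) + (B i && A j)) =
  2 * ((\sum_(i < n) A i) * (\sum_(i < n) B i)).
Proof.
under eq_bigr do rewrite big_split /=.
by rewrite big_split /= !sum_prod [X in _ + X]mulnC mul2n addnn.
Qed.

Lemma fib_gt0 f z i : i < n -> f i = z -> 0 < fib f z.
Proof. by move=> lt e; rewrite /fib (bigD1 (Ordinal lt)) //= e eqxx. Qed.

Lemma prof_gt0P f s : 0 < prof f s -> exists2 i, i < n & bsize f i = s.
Proof.
rewrite lt0n sum_nat_eq0 negb_forall => /existsP[i]; rewrite /= eqb0 negbK.
by move/eqP => e; exists i.
Qed.

Lemma prof_gt0 f i : i < n -> 0 < prof f (bsize f i).
Proof. by move=> lt; rewrite /prof (bigD1 (Ordinal lt)) //= eqxx. Qed.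

Lemma fib_le f z : fib f z <= n.
Proof.
rewrite -[X in _ <= X]card_ord -sum1_card; apply: leq_sum => i _.
by case: (_ == _).
Qed.

Lemma prof_le f s : prof f s <= n.
Proof.
rewrite -[X in _ <= X]card_ord -sum1_card; apply: leq_sum => i _.
by case: (_ == _).
Qed.

Lemma bsize_gt0 f i : i < n -> 0 < bsize f i.
Proof. by move=> lt; apply: fib_gt0 lt _. Qed.

Section Collapse.
(* [f] merges the fibres [z] and [b] of [h]; read backwards, [h] splits [f]. *)
Variables (f h : nat -> nat) (z b : nat).
Hypothesis zb : z != b.
Hypothesis fE : forall i, i < n -> f i = if h i == z then b else h i.
Let p := fib h z.
Let q := fib h b.

Lemma fib_collapse : fib f b = p + q.
Proof.
rewrite /p /q /fib -big_split; apply: eq_bigr => i _ /=; rewrite fE //.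
by case: (eqVneq (h i) z) => [->|] //=; rewrite eqxx (negbTE zb).
Qed.

Lemma fib_collapse_other y : y != z -> y != b -> fib f y = fib h y.
Proof.
move=> yz yb; apply: eq_bigr => i _ /=; rewrite fE //.
case: (eqVneq (h i) z) => [->|] //=.
by rewrite ![_ == y]eq_sym (negbTE yz) (negbTE yb).
Qed.

Lemma bsize_collapse i : i < n ->
  bsize f i = if (h i == z) || (h i == b) then p + q else bsize h i.
Proof.
move=> lt; rewrite /bsize fE //.
case: (eqVneq (h i) z) => [_|hz] /=; first exact: fib_collapse.
case: (eqVneq (h i) b) => [->|hb] /=; first exact: fib_collapse.
exact: fib_collapse_other.
Qed.

(** The vertices of the two fibres leave the counts at [p] and [q] and enter the count at [p + q].
    Keeping additions on both sides avoids truncated subtraction and covers [p = q] without a case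
    distinction. *)
Lemma prof_collapse s :
  prof f s + (p == s) * p + (q == s) * q = prof h s + (p + q == s) * (p + q).
Proof.
have Ew c w : c * fib h w = \sum_(i < n) c * (h i == w) by rewrite /fib big_distrr.
have Ep c : c * p = \sum_(i < n) c * (h i == z) by exact: Ew.
have Eq c : c * q = \sum_(i < n) c * (h i == b) by exact: Ew.
set cp : nat := (p == s); set cq : nat := (q == s); set cs : nat := (p + q == s).
rewrite mulnDr !Ep !Eq /prof -!big_split; apply: eq_bigr => i _ /=.
rewrite bsize_collapse //.
case: (eqVneq (h i) z) => [hz|hz] /=.
  by rewrite hz (negbTE zb) /bsize hz -/p -/cp -/cs; lia.
case: (eqVneq (h i) b) => [hb|hb] /=; last by lia.
by rewrite /bsize hb -/q -/cq -/cs; lia.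
Qed.

Let X i j : nat := ((h i == z) && (h j == b)) + ((h i == b) && (h j == z)).

Lemma sum_X : \sum_(i < n) \sum_(j < n) X i j = 2 * (p * q).
Proof. exact: sum_cross (fun i => h i == z) (fun i => h i == b). Qed.

Lemma collapse_pair i j : i < n -> j < n ->
  (f i == f j : nat) = (h i == h j) + X i j.
Proof.
move=> li lj; rewrite /X !fE //.
case: (eqVneq (h i) z) => [ei|hz]; case: (eqVneq (h j) z) => [ej|hz'] /=.
- by rewrite ei ej !eqxx (negbTE zb).
- by rewrite ei (negbTE zb) [b == _]eq_sym [z == _]eq_sym (negbTE hz') /=; lia.
- by rewrite ej (negbTE hz) andbT.
- by rewrite andbF /= !addn0.
Qed.

(** Only the [2 * (p * q)] ordered pairs between the two fibres change status, and each changes the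
    cost by one at most. *)
Lemma ecost_collapse a : ecost a f <= ecost a h + 2 * (p * q) /\
  ecost a h <= ecost a f + 2 * (p * q).
Proof.
rewrite -sum_X /ecost -!big_split /=; split; apply: leq_sum => i _;
  rewrite -big_split /=; apply: leq_sum => j _;
  have := collapse_pair (ltn_ord i) (ltn_ord j);
  case: (f i == f j); case: (h i == h j); case: (_ != _); case: (a i j) => /=; lia.
Qed.

(** On the pairs between the two fibres [h] agrees with [g] while [f] does not; elsewhere [f] and
    [h] coincide. [dist_merge] is the mirror image, where [g] joins the two fibres. *)
Lemma dist_split g :
  (forall i j, i < n -> j < n -> h i = z -> h j = b -> g i != g j) ->
  dist f g = dist h g + 2 * (p * q).
Proof.
move=> hg; rewrite -sum_X /dist -big_split /=; apply: eq_bigr => i _.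
rewrite -big_split /=; apply: eq_bigr => j _.
have := collapse_pair (ltn_ord i) (ltn_ord j); rewrite /X.
have gij : ((h i == z) && (h j == b)) || ((h i == b) && (h j == z)) -> g i != g j.
  case/orP=> /andP[/eqP e1 /eqP e2]; last by rewrite eq_sym; apply: hg.
  exact: hg.
move: gij; case: (_ && _); case: (_ && _) => /=;
  case: (f i == _); case: (h i == h j); case: (g i == _) => //=; try lia;
  by move=> /(_ isT).
Qed.

Lemma dist_merge g :
  (forall i j, i < n -> j < n -> h i = z -> h j = b -> g i = g j) ->
  dist h g = dist f g + 2 * (p * q).
Proof.
move=> hg; rewrite -sum_X /dist -big_split /=; apply: eq_bigr => i _.
rewrite -big_split /=; apply: eq_bigr => j _.
have := collapse_pair (ltn_ord i) (ltn_ord j); rewrite /X.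
have gij : ((h i == z) && (h j == b)) || ((h i == b) && (h j == z)) -> g i == g j.
  case/orP=> /andP[/eqP e1 /eqP e2]; last by rewrite eq_sym; apply/eqP; apply: hg.
  by apply/eqP; apply: hg.
move: gij; case: (_ && _); case: (_ && _) => /=;
  case: (f i == _); case: (h i == h j); case: (g i == _) => //=; try lia;
  by move=> /(_ isT).
Qed.

End Collapse.

Lemma exists_fresh f : exists z, forall i, i < n -> f i != z.
Proof.
exists (\sum_(i < n) f i).+1 => i lt; rewrite neq_ltn ltnS.
by rewrite (bigD1 (Ordinal lt)) //= leq_addr.
Qed.

Lemma move_towards f g : 0 < dist f g ->
  exists f' h z b, [/\ z != b, 0 < fib h z, 0 < fib h b,
    (forall i, i < n -> f' i = if h i == z then b else h i) &
    ((forall i, i < n -> f i = f' i) /\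
       dist f' g = dist h g + 2 * (fib h z * fib h b)) \/
    ((forall i, i < n -> f i = h i) /\
       dist h g = dist f' g + 2 * (fib h z * fib h b))].
Proof.
move=> d0.
case: (boolP [exists i : 'I_n, exists j : 'I_n, (f i == f j) && (g i != g j)]).
  case/existsP=> i /existsP[j /andP[/eqP fij gij]].
  have [z fz] := exists_fresh f.
  (* The vertices that both [f] and [g] put together with [i] get the fresh label [z]; [j] stays
     behind, so both parts are non-empty. *)
  pose h x := if (f x == f i) && (g x == g i) then z else f x.
  have zb : z != f i by rewrite eq_sym fz.
  have hE x : x < n -> f x = if h x == z then f i else h x.
    move=> lt; rewrite /h; case: (boolP (_ && _)) => [/andP[/eqP -> _]|_]; first by rewrite eqxx.
    by rewrite (negbTE (fz _ lt)).
  have hz x : x < n -> h x = z -> g x = g i.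
    move=> lt; rewrite /h; case: ifP => [/andP[_ /eqP ->] //|_ e].
    by move: (fz _ lt); rewrite e eqxx.
  have hb x : x < n -> h x = f i -> g x <> g i.
    move=> lt; rewrite /h; case: ifP => [_ e|h1 e e']; first by rewrite e eqxx in zb.
    by rewrite e e' !eqxx in h1.
  exists f, h, z, (f i); split=> //.
  - by apply: (fib_gt0 (i := i)) => //; rewrite /h !eqxx.
  - by apply: (fib_gt0 (i := j)) => //; rewrite /h fij [g j == _]eq_sym (negbTE gij) andbF.
  - left; split=> //; apply: dist_split => // x y lx ly ex ey.
    by rewrite (hz x) // eq_sym; apply/eqP; apply: hb.
rewrite negb_exists => /forallP ref.
have ref' x y : x < n -> y < n -> f x = f y -> g x = g y.
  move=> lx ly e; have := ref (Ordinal lx); rewrite negb_exists => /forallP /(_ (Ordinal ly)).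
  by rewrite /= e eqxx /= negbK => /eqP.
have [i [j [fij gij]]] : exists i j : 'I_n, f i != f j /\ g i = g j.
  move: d0; rewrite /dist lt0n sum_nat_eq0 negb_forall => /existsP[i].
  rewrite /= sum_nat_eq0 negb_forall => /existsP[j].
  rewrite /= eqb0 negbK => h; exists i, j.
  case: (eqVneq (f i) (f j)) h => [e|_] /=; last by move/eqP.
  by rewrite (ref' _ _ _ _ e) // eqxx.
exists (fun x => if f x == f i then f j else f x), f, (f i), (f j); split=> //.
- exact: (fib_gt0 (i := i)).
- exact: (fib_gt0 (i := j)).
- right; split=> //; apply: dist_merge => // x y lx ly ex ey.
  by rewrite (ref' _ _ lx (ltn_ord i) ex) (ref' _ _ ly (ltn_ord j) ey).
Qed.

End Labellings.

(** Selects the first [p] vertices of a fibre: those preceded by fewer than [p] members of it. *)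
Lemma fib_take (f : nat -> nat) b p n :
  \sum_(i < n) ((f i == b) && (fib i f b < p)) = minn p (fib n f b).
Proof.
elim: n => [|n IH]; first by rewrite /fib !big_ord0 minn0.
rewrite big_ord_recr /= IH [fib n.+1 f b]/fib big_ord_recr /= -/(fib n f b).
by case: (f n == b) => /=; lia.
Qed.

Lemma exists_split n (f : nat -> nat) p q : 0 < p -> 0 < q -> 0 < prof n f (p + q) ->
  exists h z b, [/\ z != b, fib n h z = p, fib n h b = q &
    forall i, i < n -> f i = if h i == z then b else h i].
Proof.
move=> p0 q0 /prof_gt0P[i0 li0 bi].
have [z fz] := exists_fresh n f; set b := f i0 in bi *.
pose h x := if (f x == b) && (fib x f b < p) then z else f x.
have zb : z != b by rewrite eq_sym fz.
have hE x : x < n -> f x = if h x == z then b else h x.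
  move=> lt; rewrite /h; case: (boolP (_ && _)) => [/andP[/eqP -> _]|_]; first by rewrite eqxx.
  by rewrite (negbTE (fz _ lt)).
have bi' : fib n f b = p + q by [].
have fp : fib n h z = p.
  rewrite -[RHS](_ : minn p (fib n f b) = p); last by lia.
  rewrite -fib_take; apply: eq_bigr => i _; rewrite /h.
  by case: ifP => _; rewrite ?eqxx // (negbTE (fz _ _)).
exists h, z, b; split=> //.
by have := fib_collapse zb hE; rewrite bi' fp; lia.
Qed.

(** For [p = q] the second bound says that at least [2 * p] vertices lie in cliques of size [p]. A
    single such clique would contain only [p] vertices, so there are two of them. *)
Lemma exists_merge n (f : nat -> nat) p q : 0 < p -> 0 < q -> p <= prof n f p ->
  q <= prof n f q - (p == q) * p ->
  exists z b, [/\ z != b, fib n f z = p & fib n f b = q].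
Proof.
move=> p0 q0 hp hq.
have [i li bi] : exists2 i, i < n & bsize n f i = p by apply: prof_gt0P; lia.
case: (eqVneq p q) hq => [e|ne] hq; last first.
  have [j lj bj] : exists2 j, j < n & bsize n f j = q by apply: prof_gt0P; lia.
  exists (f i), (f j); split=> //; apply/eqP => e.
  by move/eqP: ne; apply; rewrite -bi -bj /bsize e.
case: (boolP [exists j : 'I_n, (bsize n f j == p) && (f j != f i)]).
  case/existsP=> j /andP[/eqP bj fj].
  by exists (f i), (f j); split=> //; [rewrite eq_sym | rewrite -e].
rewrite negb_exists => /forallP h.
have : prof n f p <= fib n f (f i).
  apply: leq_sum => j _; have := h j; rewrite negb_and negbK.
  by case: (_ == p) => //=; case: (f j == _).
by rewrite -/(bsize n f i) bi; move: hp hq; rewrite -e mul1n; lia.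
Qed.

(** * Edits of single pairs and induced paths on three vertices *)

Section Toggle.
Variable n : nat.
Implicit Types (a : nat -> nat -> bool) (f : nat -> nat).

Definition good a : Prop :=
  [/\ forall i j, a i j = a j i, forall i, a i i = false &
      forall i j, a i j -> i < n].

Definition tog a x y : nat -> nat -> bool := fun i j =>
  a i j (+) (((i == x) && (j == y)) || ((i == y) && (j == x))).

Lemma good_tog a x y : good a -> x < n -> y < n -> x != y -> good (tog a x y).
Proof.
move=> [s r b] lx ly xy; split=> [i j|i|i j]; rewrite /tog.
- by rewrite s orbC ![(j == _) && _]andbC.
- rewrite r /=; case: (eqVneq i x) => [->|] //=; rewrite ?(negbTE xy) //.
  by rewrite andbF.
- case: (boolP (a i j)) => [/b //|_] /=.
  by case/orP=> /andP[/eqP -> _].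
Qed.

Lemma togK a x y i j : tog (tog a x y) x y i j = a i j.
Proof. by rewrite /tog -addbA addbb addbF. Qed.

Lemma ecost_ext a a' f : (forall i j, a i j = a' i j) -> ecost n a f = ecost n a' f.
Proof.
move=> e; apply: eq_bigr => i _; apply: eq_bigr => j _; by rewrite e.
Qed.

Lemma ecost_tog a x y f : good a -> x < n -> y < n -> x != y ->
  a x y != (f x == f y) -> ecost n a f = ecost n (tog a x y) f + 2.
Proof.
move=> [s r b] lx ly xy neq.
have sum1 z : z < n -> \sum_(i < n) (i == z :> nat) = 1.
  move=> lz; rewrite (bigD1 (Ordinal lz)) //= eqxx big1 // => i.
  by rewrite -val_eqE /= => /negbTE ->.
have -> : 2 = \sum_(i < n) \sum_(j < n)
    (((i == x :> nat) && (j == y :> nat)) + ((i == y :> nat) && (j == x :> nat))).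
  by rewrite (sum_cross n (fun i => i == x) (fun i => i == y)) !sum1.
rewrite /ecost -big_split /=; apply: eq_bigr => i _.
rewrite -big_split /=; apply: eq_bigr => j _; rewrite /tog.
case: (eqVneq (i : nat) x) => [->|ix]; case: (eqVneq (j : nat) y) => [->|jy] /=.
- rewrite xy (negbTE xy) /= [a x y (+) _]addbC; move: neq.
  by case: (a x y); case: (f x == f y).
- by rewrite (negbTE xy) /= addbF !addn0.
- case: (eqVneq (i : nat) y) => [iy|_] /=; last by rewrite addbF !addn0.
  by rewrite [y == x]eq_sym (negbTE xy) !addn0.
- case: (eqVneq (i : nat) y) => [->|_] /=; last by rewrite addbF !addn0.
  case: (eqVneq (j : nat) x) => [->|_] /=; last by rewrite addbF !addn0.
  rewrite eq_sym xy /= s [f y == _]eq_sym; move: neq.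
  by case: (a x y); case: (f x == f y).
Qed.

(** If [a] and [f] already agree on the pair, they disagree after the toggle; since toggling is an
    involution, [ecost_tog] applied to the toggled graph shows that the cost went up. *)
Lemma ecost_tog_le a x y f : good a -> x < n -> y < n -> x != y ->
  ecost n a f <= ecost n (tog a x y) f + 2.
Proof.
move=> ga lx ly xy; case: (boolP (a x y != (f x == f y))) => h.
  by rewrite (ecost_tog ga lx ly xy h).
have := @ecost_tog (tog a x y) x y f (good_tog ga lx ly xy) lx ly xy.
rewrite (ecost_ext f (togK a x y)) => ->; first by lia.
by move: h; rewrite /tog !eqxx /= negbK => /eqP ->; case: (f x == f y).
Qed.

Definition P3 a i j l : bool := [&& a i j, a j l, ~~ a i l & i != l].

(** The last path of the scan is kept. The loops of the program have no early exit and overwrite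
    earlier finds, so this is literally what [Find3] computes. *)
Definition find3 a : option (nat * nat * nat) :=
  iteri n (fun i r => iteri n (fun j r => iteri n (fun l r =>
    if P3 a i j l then Some (i, j, l) else r) r) r) None.

Lemma find3_some a i j l : find3 a = Some (i, j, l) -> P3 a i j l.
Proof.
pose ok (r : option (nat * nat * nat)) :=
  if r is Some (i, j, l) then P3 a i j l else true.
suff: ok (find3 a) by move=> h e; rewrite e in h.
have iteri_ok N F r : (forall i r, ok r -> ok (F i r)) -> ok r -> ok (iteri N F r).
  by move=> FF or; elim: N => //= N IH; apply: FF.
apply: (iteri_ok) => // i1 r1 o1; apply: (iteri_ok) => // j1 r2 o2.
by apply: (iteri_ok) => // l1 r3 o3; case: ifP.
Qed.

Lemma find3_none a i j l : find3 a = None -> i < n -> j < n -> l < n ->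
  ~~ P3 a i j l.
Proof.
have keep N (F : nat -> option (nat * nat * nat) -> option (nat * nat * nat)) r :
    (forall i r, r <> None -> F i r <> None) -> r <> None -> iteri N F r <> None.
  by move=> FF or; elim: N => //= N IH; apply: FF.
have hit N (F : nat -> option (nat * nat * nat) -> option (nat * nat * nat)) r x :
    (forall i r, r <> None -> F i r <> None) -> x < N ->
    (forall r, F x r <> None) -> iteri N F r <> None.
  move=> FF; elim: N => //= N IH lt h; case: (eqVneq x N) => [<-|ne]; first exact: h.
  by apply: FF; apply: IH => //; lia.
move=> e li lj ll; apply/negP => h; move: e.
have k3 i' j' r : r <> None ->
    iteri n (fun l r => if P3 a i' j' l then Some (i', j', l) else r) r <> None.
  by apply: keep => l' r'; case: ifP.
have k2 i' r : r <> None -> iteri n (fun j r => iteri n (fun l r =>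
    if P3 a i' j l then Some (i', j, l) else r) r) r <> None.
  by apply: keep => j' r'; apply: k3.
apply: (hit _ _ _ i) => // r.
apply: (hit _ _ _ j) => // r'; first exact: k3.
by apply: (hit _ _ _ l) => // [l' r''|r'']; [case: ifP | rewrite h].
Qed.

(** Having equal labels is a transitive relation, which the adjacencies along the path violate. *)
Lemma P3_conflict a i j l f : good a -> P3 a i j l ->
  [|| a i j != (f i == f j), a j l != (f j == f l) | a i l != (f i == f l)].
Proof.
move=> _ /and4P[-> -> /negbTE -> _].
by case: (eqVneq (f i) (f j)) => //= ->; case: (f j == f l).
Qed.

Lemma P3_lt a i j l : good a -> P3 a i j l ->
  [/\ i < n, j < n & l < n] /\ [/\ i != j, j != l & i != l].
Proof.
move=> [s r b] /and4P[h1 h2 h3 h4]; split; split=> //.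
- exact: b h1.
- exact: b h2.
- by rewrite s in h2; apply: b h2.
- by apply: contraTneq h1 => ->; rewrite r.
- by apply: contraTneq h2 => ->; rewrite r.
Qed.

Section NoP3.
Variable a : nat -> nat -> bool.
Hypothesis ga : good a.
Hypothesis noP3 : find3 a = None.

(** The least vertex of the closed neighbourhood of [i]. Without induced paths closed neighbourhoods
    are the cliques, so this picks one representative per clique. *)
Definition lbl i : nat := find (fun j => (i == j) || a i j) (iota 0 n).

Let rl i j := (i == j) || a i j.

Lemma rl_sym i j : rl i j = rl j i.
Proof. by rewrite /rl eq_sym; case: ga => ->. Qed.

Lemma rl_trans i j l : i < n -> j < n -> l < n -> rl i j -> rl j l -> rl i l.
Proof.
move=> li lj ll; rewrite /rl.
case: (eqVneq i j) => [->|ij] //= aij.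
case: (eqVneq j l) => [<-|jl] /= ajl; first by rewrite aij orbT.
have := find3_none noP3 li lj ll; rewrite /P3 aij ajl /=.
by case: (a i l); case: (i == l).
Qed.

Lemma lbl_eq i j : i < n -> j < n -> (lbl i == lbl j) = (i == j) || a i j.
Proof.
have mem x : x < n -> x \in iota 0 n by rewrite mem_iota.
have has_i x : x < n -> has (fun y => (x == y) || a x y) (iota 0 n).
  by move=> lx; apply/hasP; exists x; rewrite ?mem // eqxx.
move=> li lj; apply/eqP/idP => [e|h].
  have li' : lbl i < n by rewrite -[X in _ < X](size_iota 0) -has_find has_i.
  have := nth_find 0 (has_i _ li); have := nth_find 0 (has_i _ lj).
  rewrite -/(lbl i) -/(lbl j) -e !nth_iota // add0n => h1 h2.
  by apply: (rl_trans (j := lbl i)) => //; rewrite rl_sym.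
apply: eq_in_find => x; rewrite mem_iota /= add0n => lx.
apply/idP/idP; first by apply: rl_trans => //; rewrite rl_sym.
exact: rl_trans.
Qed.

Lemma ecost_lbl f : ecost n a f = dist n lbl f.
Proof.
apply: eq_bigr => i _; apply: eq_bigr => j _; rewrite lbl_eq //.
case: (eqVneq (i : nat) j) => [->|] //=; by rewrite eqxx.
Qed.

(** The size of the closed neighbourhood, which in the absence of induced paths is the size of the
    clique of [i]; the machine gets the initial profile from these numbers. *)
Definition dg i : nat := 1 + \sum_(j < n) a i j.

Lemma bsize_lbl i : i < n -> bsize n lbl i = dg i.
Proof.
move=> li; rewrite /bsize /fib /dg.
have -> : 1 = \sum_(j < n) (j == i :> nat).
  rewrite (bigD1 (Ordinal li)) //= eqxx big1 // => j.
  by rewrite -val_eqE /= => /negbTE ->.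
rewrite -big_split; apply: eq_bigr => j _ /=; rewrite eq_sym lbl_eq //.
rewrite eq_sym; case: (eqVneq (j : nat) i) => [->|] //=.
by case: ga => _ ->.
Qed.

Definition prof0 s : nat := \sum_(i < n) (dg i == s).

Lemma prof_lbl s : prof n lbl s = prof0 s.
Proof. by apply: eq_bigr => i _; rewrite bsize_lbl. Qed.

End NoP3.
End Toggle.

(** * Runs driven by digit strings *)

Lemma eq_prof n f f' s : (forall i, i < n -> f i = f' i) -> prof n f s = prof n f' s.
Proof.
move=> e; apply: eq_bigr => i _; rewrite /bsize /fib e //.
by congr (nat_of_bool (_ == s)); apply: eq_bigr => j _; rewrite e.
Qed.

Lemma eq_dist n f f' g : (forall i, i < n -> f i = f' i) -> dist n f g = dist n f' g.
Proof. by move=> e; apply: eq_bigr => i _; apply: eq_bigr => j _; rewrite !e. Qed.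

Lemma prof_dist0 n f g s : dist n f g = 0 -> prof n f s = prof n g s.
Proof.
move=> /eqP; rewrite sum_nat_eq0 => /forallP d0.
have e (i j : 'I_n) : (f i == f j) = (g i == g j).
  have := d0 i; rewrite /= sum_nat_eq0 => /forallP /(_ j).
  by rewrite /= eqb0 negb_add => /eqP.
apply: eq_bigr => i _; congr (nat_of_bool (_ == s)).
by apply: eq_bigr => j _; rewrite e.
Qed.

(** State of the second phase: the profile, the part sizes announced for the next move, the edits
    paid so far, and a flag raised by an impossible move. *)
Record rst := Rst { rN : nat -> nat; rp : nat; rq : nat; rc : nat; rb : bool }.

Section Runs.
Variables (n k eta cap : nat).

Definition cadd x y : nat := minn (x + y) cap.

Definition updf (N : nat -> nat) s v : nat -> nat := fun t => if t == s then v else N t.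

Definition dosplit (N : nat -> nat) p q : nat -> nat :=
  let s := cadd p q in
  let N1 := updf N s (N s - s) in
  let N2 := updf N1 p (cadd (N1 p) p) in
  updf N2 q (cadd (N2 q) q).

Definition domerge (N : nat -> nat) p q : nat -> nat :=
  let N1 := updf N p (N p - p) in
  let N2 := updf N1 q (N1 q - q) in
  let s := cadd p q in
  updf N2 s (cadd (N2 s) s).

(* A split or merge with parts [p] and [q] costs [p * q] edits and is written
   with [p + q - 1 <= p * q] digits: [p - 1] digits 2, [q - 1] digits 3, and the
   digit 0 (split) or 1 (merge). *)
Definition step2 (st : rst) (d : nat) : rst :=
  let: Rst N p q c b := st in
  match d with
  | 0 => Rst (dosplit N p q) 1 1 (cadd c (p * q)) (b || (N (cadd p q) < cadd p q))
  | 1 => Rst (domerge N p q) 1 1 (cadd c (p * q))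
           [|| b, N p < p | updf N p (N p - p) q < q]
  | 2 => Rst N (cadd p 1) q c b
  | _ => Rst N p (cadd q 1) c b
  end.

Definition pick3 (a : nat -> nat -> bool) (t : nat * nat * nat) (d : nat) :=
  let: (u, v, w) := t in
  match d with 0 => tog a u v | 1 => tog a v w | _ => tog a u w end.

Fixpoint ph1 (ds : seq nat) (a : nat -> nat -> bool) :=
  match find3 n a, ds with
  | Some t, d :: ds' => ph1 ds' (pick3 a t d)
  | _, _ => (a, ds)
  end.

(** The shift by one makes the sizes range over 1 to [cap]. Truncated subtraction suffices because
    every pair of sizes is met in both orders. *)
Definition balb (N : nat -> nat) : bool :=
  all (fun s => all (fun t => [|| N s.+1 == 0, N t.+1 == 0 | s - t <= eta])
    (iota 0 cap)) (iota 0 cap).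

Definition init2 (a : nat -> nat -> bool) c : rst := Rst (prof0 n a) 1 1 c false.

Definition acceptb (ds : seq nat) (a : nat -> nat -> bool) : bool :=
  let: (a', rest) := ph1 ds a in
  let st := foldl step2 (init2 a' (size ds - size rest)) rest in
  [&& find3 n a' == None, ~~ rb st, rc st <= k & balb (rN st)].

Hypothesis capP : n + k + 2 <= cap.

(** The updates are made one after the other, so for [p = q] the same entry is raised twice. The
    truncations have no effect, since the final counts [H] are bounded by [cap]. *)
Lemma dosplitE N H p q : 0 < p -> 0 < q -> p + q <= cap -> p + q <= N (p + q) ->
  (forall t, N t + (p == t) * p + (q == t) * q = H t + (p + q == t) * (p + q)) ->
  (forall t, H t <= cap) -> forall t, dosplit N p q t = H t.
Proof.
move=> p0 q0 pq Npq e Hc t.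
have -> : dosplit N p q t = (if t == q then
    minn ((if q == p then minn (N p + p) cap else N q) + q) cap
  else if t == p then minn (N p + p) cap
  else if t == p + q then N t - (p + q) else N t).
  rewrite /dosplit /updf /= /cadd (minn_idPl pq).
  rewrite (_ : (p == p + q) = false); last lia.
  rewrite (_ : (q == p + q) = false); last lia.
  by case: (eqVneq t q) => // _; case: (eqVneq t p) => // _; case: (eqVneq t (p + q)) => [->|].
have := e t; have := Hc t; have := e p; have := Hc p.
case: (eqVneq t q) => [->|tq]; first by case: (eqVneq q p) => [->|]; rewrite !eqxx; lia.
case: (eqVneq t p) => [->|tp]; first by rewrite !eqxx; lia.
case: (eqVneq t (p + q)) => [->|tpq]; first by rewrite !eqxx; lia.
lia.
Qed.

Lemma domergeE N H p q : 0 < p -> 0 < q -> p + q <= cap ->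
  (forall t, H t + (p == t) * p + (q == t) * q = N t + (p + q == t) * (p + q)) ->
  (forall t, H t <= cap) ->
  [/\ forall t, domerge N p q t = H t, p <= N p & q <= updf N p (N p - p) q].
Proof.
move=> p0 q0 pq e Hc; split=> [t||].
- have -> : domerge N p q t = (if t == p + q then minn (N t + (p + q)) cap
    else if t == q then (if q == p then N p - p else N q) - q
    else if t == p then N t - p else N t).
    rewrite /domerge /updf /= /cadd (minn_idPl pq).
    rewrite (_ : (p + q == q) = false); last lia.
    rewrite (_ : (p + q == p) = false); last lia.
    case: (eqVneq t (p + q)) => [->|] // _; case: (eqVneq t q) => // _.
    by case: (eqVneq t p) => [->|].
  have := e t; have := Hc t; have := e p; have := Hc p.
  case: (eqVneq t (p + q)) => [->|tpq]; first by rewrite !eqxx; lia.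
  case: (eqVneq t q) => [->|tq]; first by case: (eqVneq q p) => [->|]; rewrite !eqxx; lia.
  case: (eqVneq t p) => [->|tp]; first by rewrite !eqxx; lia.
  lia.
- by have := e p; rewrite eqxx; lia.
- rewrite /updf; have := e p; have := e q; rewrite !eqxx eq_sym.
  by case: (eqVneq p q) => [->|] /=; lia.
Qed.

Section Sound.
Variable a : nat -> nat -> bool.

(** Either the run is already lost, by an invalid move or by a cost above [k], and stays so; or the
    profile belongs to an actual labelling whose edit cost is covered by the recorded cost. *)
Definition inv2 (st : rst) : Prop :=
  [/\ 0 < rp st, 0 < rq st & [\/ rb st, k < rc st |
    exists f, (forall s, rN st s = prof n f s) /\ ecost n a f <= 2 * rc st]].

Lemma step2_sound st d : inv2 st -> inv2 (step2 st d).
Proof.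
case: st => N p q c b [/= p0 q0 I].
case: d => [|[|[|d]]]; last first.
- by split=> //=; rewrite /cadd; lia.
- by split=> //=; rewrite /cadd; lia.
- split=> //=; case: I => [->|kc|[f [Nf ef]]]; first by constructor 1.
    by constructor 2; rewrite /cadd; lia.
  case: (leqP p (N p)) => hp; last by constructor 1; rewrite orbT.
  case: (leqP q _) => hq; last by constructor 1; rewrite !orbT.
  (* The second test is made after [p] has been taken off, which for equal sizes is exactly the
     extra subtraction in [exists_merge]. *)
  have [z [b' [zb fz fb]]] : exists z b, [/\ z != b, fib n f z = p & fib n f b = q].
    apply: exists_merge => //; first by rewrite -Nf.
    move: hq; rewrite /updf eq_sym; case: (eqVneq p q) => [<-|] /=; rewrite Nf; lia.
  pose g x := if f x == z then b' else f x.
  have gE x : x < n -> g x = if f x == z then b' else f x by [].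
  have pq : p + q <= n by rewrite -fz -fb -(fib_collapse zb gE) fib_le.
  have [|||DM _ _] := @domergeE N (prof n g) p q p0 q0 _ _ _; first by lia.
  + by move=> t; rewrite Nf -{1 2}fz -{1 2}fb (prof_collapse zb gE) fz fb.
  + by move=> t; apply: leq_trans (prof_le _ _ _) _; lia.
  (* If the cost overflows, the recorded value is [cap], which exceeds [k], and the run is lost. *)
  case: (leqP (c + p * q) cap) => cc; last by constructor 2; rewrite /cadd; lia.
  constructor 3; exists g; split=> //.
  have [h1 _] := ecost_collapse zb gE a; rewrite fz fb in h1.
  rewrite /cadd; lia.
- split=> //=; case: I => [->|kc|[f [Nf ef]]]; first by constructor 1.
    by constructor 2; rewrite /cadd; lia.
  case: (leqP (cadd p q) _) => hs; last by constructor 1; rewrite orbT.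
  have [i li bi] : exists2 i, i < n & bsize n f i = cadd p q.
    by apply: prof_gt0P; rewrite -Nf; apply: leq_trans hs; rewrite /cadd; lia.
  (* A clique of this size exists, so the size is at most [n], hence below [cap]: the sum [p + q]
     was not truncated. *)
  have sn : cadd p q <= n by rewrite -bi; apply: fib_le.
  have sE : cadd p q = p + q by move: sn; rewrite /cadd; lia.
  rewrite sE in hs bi sn.
  have [h [z [b' [zb fz fb hE]]]] : exists h z b, [/\ z != b, fib n h z = p,
      fib n h b = q & forall i, i < n -> f i = if h i == z then b else h i].
    by apply: exists_split => //; rewrite -Nf; lia.
  case: (leqP (c + p * q) cap) => cc; last by constructor 2; rewrite /cadd; lia.
  constructor 3; exists h; split.
    apply: dosplitE => //; first by lia.
      by move=> t; rewrite Nf -{1 2}fz -{1 2}fb (prof_collapse zb hE) fz fb.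
    by move=> t; apply: leq_trans (prof_le _ _ _) _; lia.
  have [_ h1] := ecost_collapse zb hE a; rewrite fz fb in h1.
  rewrite /cadd; lia.
Qed.

Lemma foldl_step2_sound ds st : inv2 st -> inv2 (foldl step2 st ds).
Proof. by elim: ds st => //= d ds IH st /(step2_sound d)/IH. Qed.

End Sound.

Lemma balbP f N : (forall s, N s = prof n f s) ->
  reflect (forall i j, i < n -> j < n -> bsize n f i - bsize n f j <= eta) (balb N).
Proof.
move=> Nf; apply: (iffP allP) => [h i j li lj|h s _].
  have bi := bsize_gt0 f li; have bj := bsize_gt0 f lj.
  have bi' : bsize n f i <= n by apply: fib_le.
  have bj' : bsize n f j <= n by apply: fib_le.
  have/allP := h (bsize n f i).-1 ltac:(rewrite mem_iota; lia).
  move=> /(_ (bsize n f j).-1 ltac:(rewrite mem_iota; lia)).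
  rewrite !prednK // !Nf.
  by have := prof_gt0 f li; have := prof_gt0 f lj; lia.
apply/allP => t _; rewrite !Nf.
case: (posnP (prof n f s.+1)) => [_|/prof_gt0P[i li bi]] //.
case: (posnP (prof n f t.+1)) => [_|/prof_gt0P[j lj bj]] //.
by have := h i j li lj; rewrite bi bj; lia.
Qed.

Lemma foldl_rp N x q c b j : x + j <= cap ->
  foldl step2 (Rst N x q c b) (nseq j 2) = Rst N (x + j) q c b.
Proof.
elim: j x => [|j IH] x h /=; first by rewrite addn0.
by rewrite /cadd (minn_idPl _) ?IH; [congr Rst; lia| lia | lia].
Qed.

Lemma foldl_rq N p x c b j : x + j <= cap ->
  foldl step2 (Rst N p x c b) (nseq j 3) = Rst N p (x + j) c b.
Proof.
elim: j x => [|j IH] x h /=; first by rewrite addn0.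
by rewrite /cadd (minn_idPl _) ?IH; [congr Rst; lia| lia | lia].
Qed.

Definition code op p q : seq nat := nseq p.-1 2 ++ nseq q.-1 3 ++ [:: op].

(** Amounts to [(p - 1) * (q - 1)] being non-negative. *)
Lemma size_code op p q : 0 < p -> 0 < q -> size (code op p q) <= p * q.
Proof. by rewrite !size_cat !size_nseq /=; nia. Qed.

Lemma foldl_code op p q N c : 0 < p <= cap -> 0 < q <= cap ->
  foldl step2 (Rst N 1 1 c false) (code op p q) = step2 (Rst N p q c false) op.
Proof.
move=> hp hq; rewrite /code !foldl_cat foldl_rp; last lia.
by rewrite foldl_rq; [congr step2; congr Rst; lia | lia].
Qed.

(** Strong induction on the budget [m]: the move given by [move_towards] lowers the distance by
    [2 * (p * q)], and its code uses at most [p * q] digits. The code also resets the pending sizes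
    to 1, ready for the next move. *)
Lemma moves_complete g m f N c : dist n f g <= 2 * m -> c + m <= k ->
  (forall s, N s = prof n f s) ->
  exists ds, [/\ size ds <= m, all (fun d => d < 4) ds &
    let st := foldl step2 (Rst N 1 1 c false) ds in
    [/\ forall s, rN st s = prof n g s, rp st = 1, rq st = 1, rc st <= c + m &
        rb st = false]].
Proof.
elim/ltn_ind: m f N c => m IH f N c dm ck Nf.
case: (posnP (dist n f g)) => [d0|d0].
  exists [::]; split=> //=; split=> // [s|]; last by lia.
  by rewrite Nf (prof_dist0 _ d0).
have [f' [h [z [b [zb p0 q0 hE mv]]]]] := move_towards d0.
set p := fib n h z in p0 mv; set q := fib n h b in q0 mv.
have pq : p + q <= n by rewrite -(fib_collapse zb hE) fib_le.
have p0q0 : 0 < p * q by rewrite muln_gt0 p0.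
have cle t u : prof n u t <= cap by apply: leq_trans (prof_le _ _ _) _; lia.
have PC t := prof_collapse zb hE t; rewrite -/p -/q in PC.
have allc op : op < 4 -> all (fun d => d < 4) (code op p q).
  by move=> h4; rewrite !all_cat !all_nseq /= h4 !orbT.
have scode op := @size_code op p q p0 q0.
have fcode op := @foldl_code op p q N c ltac:(lia) ltac:(lia).
case: mv => [[ff' dd]|[fh dd]].
  rewrite (eq_dist _ ff') in dm.
  have pqN : p + q <= N (p + q).
    by rewrite Nf (eq_prof _ ff'); have := PC (p + q); rewrite eqxx; lia.
  have DS : forall t, dosplit N p q t = prof n h t.
    by apply: dosplitE => //; [lia | move=> t; rewrite Nf (eq_prof _ ff')].
  have [|||ds [sz al R]] := IH (m - p * q) _ h (dosplit N p q) (c + p * q) _ _ DS; try lia.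
  exists (code 0 p q ++ ds); split.
  - by rewrite size_cat; have := scode 0; lia.
  - by rewrite all_cat allc.
  - rewrite /= foldl_cat fcode /= /cadd !(minn_idPl _); try lia.
    rewrite (_ : _ < _ = false); last lia.
    by move: R => /= [r1 r2 r3 r4 r5]; split=> //; lia.
rewrite (eq_dist _ fh) in dm.
have [|||DM hp hq] := @domergeE N (prof n f') p q p0 q0 _ _ _; first by lia.
- by move=> t; rewrite Nf (eq_prof _ fh).
- by move=> t; apply: cle.
have [|||ds [sz al R]] := IH (m - p * q) _ f' (domerge N p q) (c + p * q) _ _ DM; try lia.
exists (code 1 p q ++ ds); split.
- by rewrite size_cat; have := scode 1; lia.
- by rewrite all_cat allc.
- rewrite /= foldl_cat fcode /= ![_ < _]ltnNge hp hq /= /cadd !(minn_idPl _); try lia.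
  by move: R => /= [r1 r2 r3 r4 r5]; split=> //; lia.
Qed.

Lemma good_pick3 a i j l d : good n a -> P3 a i j l -> good n (pick3 a (i, j, l) d).
Proof.
move=> ga h; have [[li lj ll] [ij jl il]] := P3_lt ga h.
by case: d => [|[|d]]; apply: good_tog.
Qed.

(** Each digit consumed toggles one pair, which accounts for at most 2 in the ordered count,
    whichever labelling [f] is compared with. *)
Lemma ph1_sound ds a : good n a ->
  [/\ good n (ph1 ds a).1, size (ph1 ds a).2 <= size ds &
   forall f, ecost n a f <=
     ecost n (ph1 ds a).1 f + 2 * (size ds - size (ph1 ds a).2)].
Proof.
elim: ds a => [|d ds IH] a ga /=.
  by case: (find3 n a) => [t|]; split=> // f; rewrite leq_addr.
case e: (find3 n a) => [[[i j] l]|]; last by split=> //= f; rewrite leq_addr.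
have h := find3_some e.
have [g1 s1 c1] := IH _ (good_pick3 d ga h).
split=> [//||f]; first exact: leq_trans s1 _.
apply: leq_trans (_ : _ <= ecost n (pick3 a (i, j, l) d) f + 2) _.
  have [[li lj ll] [ij jl il]] := P3_lt ga h.
  by case: d {IH g1 s1 c1} => [|[|d]]; apply: ecost_tog_le.
by have := c1 f; lia.
Qed.

(** On every path found, the digit is chosen to repair a pair on which the graph disagrees with [f].
    The cost then falls by exactly 2 per digit, so the remaining budget fits the remaining
    distance. *)
Lemma ph1_complete f m a : good n a -> ecost n a f <= 2 * m ->
  exists ds1 a', [/\ size ds1 <= m, all (fun d => d < 4) ds1, good n a',
     find3 n a' = None /\ ecost n a f = ecost n a' f + 2 * size ds1 &
     forall ds2, ph1 (ds1 ++ ds2) a = (a', ds2)].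
Proof.
elim: m a => [|m IH] a ga ec; case e: (find3 n a) => [[[i j] l]|];
  try by exists [::], a; split=> //; [split=> //=; lia | case=> [|d ds2] /=; rewrite e].
all: have h := find3_some e; have [[li lj ll] [ij jl il]] := P3_lt ga h.
  (* Budget zero with a path left is impossible: the conflict alone costs 2. *)
  have := P3_conflict f ga h.
  by case/or3P=> cf; [have := ecost_tog ga li lj ij cf | have := ecost_tog ga lj ll jl cf
    | have := ecost_tog ga li ll il cf]; lia.
have [d d4 ed] : exists2 d, d < 4 & ecost n a f = ecost n (pick3 a (i, j, l) d) f + 2.
  case/or3P: (P3_conflict f ga h) => cf.
  - by exists 0 => //=; apply: ecost_tog.
  - by exists 1 => //=; apply: ecost_tog.
  - by exists 2 => //=; apply: ecost_tog.
have [|ds1 [a' [s1 l1 g1 [n1 e1] p1]]] := IH _ (good_pick3 d ga h); first by lia.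
exists (d :: ds1), a'; split=> //=; first by rewrite d4.
  by split=> //; lia.
by move=> ds2; rewrite e p1.
Qed.

Lemma acceptb_iff a : good n a ->
  (exists ds, [/\ size ds = k, all (fun d => d < 4) ds & acceptb ds a]) <->
  (exists f : nat -> nat, ecost n a f <= 2 * k /\
     forall i j, i < n -> j < n -> bsize n f i - bsize n f j <= eta).
Proof.
move=> ga; split=> [[ds [sz _]]|[f [ef bf]]].
  rewrite /acceptb; have := ph1_sound ds ga.
  case: (ph1 ds a) => a' rest /= [ga' sr ec] /and4P[/eqP nf nb ck bb].
  move: nb ck bb; set st := foldl _ _ _ => nb ck bb.
  have [|_ _] := @foldl_step2_sound a rest (init2 a' (size ds - size rest)) _.
  (* The second phase starts from the cliques of [a'] themselves, at distance zero from [a'], so the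
     cost from [a] is only that of the digits spent. *)
  - split=> //=; constructor 3; exists (lbl n a'); split.
      by move=> s; rewrite (prof_lbl ga' nf).
    apply: leq_trans (ec _) _; rewrite (ecost_lbl ga' nf) /dist.
    by rewrite big1 // => i _; rewrite big1 // => j _; rewrite addbb.
  - rewrite -/st => [[h|h|[f [Nf ef]]]]; first by rewrite h in nb.
      by rewrite ltnNge ck in h.
    by exists f; split; [lia | apply/balbP: bb].
have [ds1 [a' [s1 l1 g1 [nf e1] p1]]] := ph1_complete ga ef.
have [|||ds2 [s2 l2 /= [r1 r2 r3 r4 r5]]] :=
  @moves_complete f (k - size ds1) (lbl n a') (prof0 n a') (size ds1).
- by rewrite -(ecost_lbl g1 nf); lia.
- by lia.
- by move=> s; rewrite (prof_lbl g1 nf).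
(* Filling up with the digit 2 raises the pending size [rp] only; profile, cost and flag stay as
   they are. *)
set pad := nseq (k - size ds1 - size ds2) 2.
exists (ds1 ++ (ds2 ++ pad)); split.
- by rewrite !size_cat size_nseq; lia.
- by rewrite !all_cat l1 l2 all_nseq orbT.
rewrite /acceptb p1 nf eqxx /= !size_cat foldl_cat.
rewrite (_ : size ds1 + _ - _ = size ds1); last lia.
move: r1 r2 r3 r4 r5; rewrite -/(init2 _ _); case: (foldl _ _ _) => N p q c b /=.
move=> r1 -> -> r4 ->; rewrite foldl_rp /=; last lia.
apply/andP; split; first by lia.
by apply/(balbP r1).
Qed.

End Runs.

(** * Cluster editings as labellings *)

Section Equivalence.
Variable n : nat.
Implicit Types E F : {set {set 'I_n}}.

Definition mat E (i j : nat) : bool :=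
  [exists x : 'I_n, exists y : 'I_n, [&& x == i :> nat, y == j :> nat & adj E x y]].

Lemma mat_ord E (x y : 'I_n) : mat E x y = adj E x y.
Proof.
apply/existsP/idP => [[x' /existsP[y' /and3P[/eqP/val_inj -> /eqP/val_inj -> //]]]|h].
by exists x; apply/existsP; exists y; rewrite !eqxx.
Qed.

Lemma adj_sym E x y : adj E x y = adj E y x.
Proof. by rewrite /adj /= setUC. Qed.

Lemma adj_irr E x : E \subset pairs 'I_n -> adj E x x = false.
Proof.
move=> /subsetP sE; apply/negP => /sE; rewrite inE setUid cards1.
by [].
Qed.

Lemma good_mat E : E \subset pairs 'I_n -> good n (mat E).
Proof.
move=> sE; split=> [i j|i|i j].
- apply/existsP/existsP => [] [x /existsP[y /and3P[h1 h2 h3]]]; exists y;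
    by apply/existsP; exists x; rewrite h1 h2 adj_sym.
- apply/negbTE/negP => /existsP[x /existsP[y /and3P[/eqP <- /eqP/val_inj ->]]].
  by rewrite adj_irr.
- by case/existsP=> x /existsP[y /and3P[/eqP <-]].
Qed.

Lemma adj_symdiff E F x y : adj (symdiff E F) x y = adj E x y (+) ([set x; y] \in F).
Proof.
by rewrite /adj /= !inE; case: (_ \in E); case: (_ \in F).
Qed.

(** Double counting: a two-element set arises from exactly two ordered pairs, and the diagonal
    yields singletons, which are not in [F]. *)
Lemma sum_pairs F : F \subset pairs 'I_n ->
  \sum_(x < n) \sum_(y < n) ([set x; y] \in F) = 2 * #|F|.
Proof.
move=> /subsetP sF.
have -> : 2 * #|F| = \sum_(A in F) \sum_(x < n) \sum_(y < n) ([set x; y] == A).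
  rewrite -sum1_card big_distrr /=; apply: eq_bigr => A /sF.
  rewrite inE => /cards2P[x [y [xy ->]]].
  rewrite pair_big /= (bigD1 (x, y)) //= eqxx (bigD1 (y, x)) /=; last first.
    by rewrite xpair_eqE eq_sym (negbTE xy).
  rewrite setUC eqxx big1 // => -[u v] /=; rewrite !xpair_eqE => /andP[h1 h2].
  apply/eqP; rewrite eqb0; apply/eqP => e.
  have ux : u \in [set x; y] by rewrite -e !inE eqxx.
  have vx : v \in [set x; y] by rewrite -e !inE eqxx orbT.
  have xu : x \in [set u; v] by rewrite e !inE eqxx.
  have yu : y \in [set u; v] by rewrite e !inE eqxx orbT.
  move: ux vx xu yu h1 h2; rewrite !inE.
  case/orP=> /eqP ->; case/orP=> /eqP ->; rewrite ?eqxx ?andbT //=;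
    rewrite ?[y == x]eq_sym ?(negbTE xy) //.
rewrite [RHS]exchange_big /=; apply: eq_bigr => x _.
rewrite [RHS]exchange_big /=; apply: eq_bigr => y _.
case: (boolP (_ \in F)) => h.
  by rewrite (bigD1 _ h) /= eqxx big1 // => A /andP[_ /negbTE]; rewrite eq_sym => ->.
rewrite big1 // => A hA; case: eqP => // e.
by rewrite e hA in h.
Qed.

Lemma component_eq E x y : (component E x == component E y) = connect (adj E) x y.
Proof.
have cs : connect_sym (adj E) by apply: sym_connect_sym => u v; apply: adj_sym.
apply/eqP/idP => [e|h].
  have : y \in component E y by rewrite inE connect0.
  by rewrite -e inE.
by apply/setP => z; rewrite !inE (same_connect cs h).
Qed.

Lemma bce_labelling E k eta : E \subset pairs 'I_n ->
  balanced_cluster_editing E k eta <->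
  (exists f : nat -> nat, ecost n (mat E) f <= 2 * k /\
     forall i j, i < n -> j < n -> bsize n f i - bsize n f j <= eta).
Proof.
move=> sE; split=> [[F [sF cF clF bF]]|[f [ef bf]]].
  set E' := symdiff E F in clF bF.
  (* Vertices are labelled by the rank of their component; the value 0 beyond [n] is a mere
     default. *)
  pose f i : nat := if insub i is Some x then enum_rank (component E' x) else 0.
  have fE (x : 'I_n) : f x = enum_rank (component E' x).
    by rewrite /f insubT //= => h; congr (nat_of_ord (enum_rank (component E' _))); apply: val_inj.
  have feq (x y : 'I_n) : (f x == f y) = connect (adj E') x y.
    rewrite !fE -component_eq; apply/eqP/eqP => [/val_inj/enum_rank_inj //|->//].
  have fadj (x y : 'I_n) : x != y -> (f x == f y) = adj E' x y.
    move=> xy; rewrite feq; apply/idP/idP => [h|]; last exact: connect1.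
    apply: (clF (component E' x)) => //; rewrite ?inE ?connect0 //.
    by apply/imsetP; exists x.
  have bs (x : 'I_n) : bsize n f x = #|component E' x|.
    rewrite /bsize /fib -sum1_card [RHS]big_mkcond /=; apply: eq_bigr => y _.
    by rewrite eq_sym feq inE; case: connect.
  exists f; split; last first.
    move=> i j li lj; have := bF (component E' (Ordinal li)) (component E' (Ordinal lj)).
    rewrite -!bs /=.
    move=> /(_ ltac:(by apply/imsetP; eexists) ltac:(by apply/imsetP; eexists)).
    lia.
  apply: leq_trans (_ : 2 * #|F| <= _); last by rewrite leq_mul2l.
  rewrite -sum_pairs //; apply: leq_sum => x _; apply: leq_sum => y _.
  rewrite mat_ord; case: (eqVneq (x : nat) y) => //= xy.
  rewrite fadj // /E' adj_symdiff addbA addbb addFb //.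
(* The edits are the pairs on which [E] and the labelling disagree. *)
pose F := [set A in pairs 'I_n | [exists x : 'I_n, exists y : 'I_n,
   [&& A == [set x; y], x != y & adj E x y (+) (f x == f y)]]].
have inF (x y : 'I_n) : x != y -> ([set x; y] \in F) = adj E x y (+) (f x == f y).
  move=> xy; rewrite !inE cards2 xy /=.
  apply/existsP/idP => [[u /existsP[v /and3P[/eqP e uv h]]]|h]; last first.
    by exists x; apply/existsP; exists y; rewrite eqxx xy.
  have xu : x \in [set u; v] by rewrite -e !inE eqxx.
  have yu : y \in [set u; v] by rewrite -e !inE eqxx orbT.
  move: xu yu xy; rewrite !inE.
  case/orP=> /eqP ->; case/orP=> /eqP ->; rewrite ?eqxx //.
  by rewrite adj_sym [f v == _]eq_sym.
have sF : F \subset pairs 'I_n by apply/subsetP => A; rewrite inE => /andP[].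
set E' := symdiff E F.
have adjE' (x y : 'I_n) : x != y -> adj E' x y = (f x == f y).
  by move=> xy; rewrite adj_symdiff inF // addbA addbb.
(* After the edits, distinct vertices are adjacent exactly when their labels agree; this is
   transitive, so connectivity adds nothing. *)
have conE' (x y : 'I_n) : connect (adj E') x y = (f x == f y).
  apply/idP/idP => [/connectP[p]|h]; last first.
    case: (eqVneq x y) => [->|xy]; first exact: connect0.
    by apply: connect1; rewrite adjE'.
  elim: p x => [|z p IH] x /=; first by move=> _ ->.
  case/andP=> h1 h2 h3; rewrite -(eqP (IH z h2 h3)).
  by case: (eqVneq x z) h1 => [->|xz] //; rewrite adjE'.
have bs (x : 'I_n) : bsize n f x = #|component E' x|.
  rewrite /bsize /fib -sum1_card [RHS]big_mkcond /=; apply: eq_bigr => y _.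
  by rewrite inE conE' eq_sym; case: (_ == _).
exists F; split=> //.
- rewrite -(leq_pmul2l (_ : 0 < 2)) // -sum_pairs //; apply: leq_trans ef.
  apply: leq_sum => x _; apply: leq_sum => y _.
  case: (eqVneq x y) => [<-|xy].
    suff -> : ([set x; x] \in F) = false by [].
    by apply/negP => /(subsetP sF); rewrite inE setUid cards1.
  rewrite inF // mat_ord (_ : (x != y :> nat)) //.
- move=> H /imsetP[x _ ->] u v; rewrite !inE !conE' => /eqP e1 /eqP e2 uv.
  by rewrite adjE' // -e1 e2.
- move=> H H' /imsetP[x _ ->] /imsetP[y _ ->]; rewrite -!bs.
  have := bf x y (ltn_ord x) (ltn_ord y); have := bf y x (ltn_ord y) (ltn_ord x).
  lia.
Qed.

End Equivalence.

(** * The algorithm *)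

Notation "c1 ;; c2" := (CSeq c1 c2) (at level 60, right associativity).
Notation "x ::= e" := (CSet x e) (at level 50).

(* Variables:
   0 n, 1 k, 2 eta, 3 answer, 4 loop flag, 5-7 indices, 8 "P3 found",
   9-11 the P3, 12 digits used by phase 1, 13 current digit, 14-15 p and q,
   16 cost, 17 "invalid move", 18 digit index, 19 carry, 20-21 pair to toggle,
   22 size or degree, 23 input pointer.
   Arrays: 0 input matrix, 1 working matrix, 2 digits, 3 profile, 4 saved input. *)

Definition Test3 : com :=
  CIf (EGet 1 (EV 5) (EV 6))
   (CIf (EGet 1 (EV 6) (EV 7))
     (CIf (EGet 1 (EV 5) (EV 7)) CSkip
       (CIf (EAdd (ESub (EV 5) (EV 7)) (ESub (EV 7) (EV 5)))
         (8 ::= EC 1;; 9 ::= EV 5;; 10 ::= EV 6;; 11 ::= EV 7)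
         CSkip))
     CSkip)
   CSkip.

Definition Find3 : com :=
  8 ::= EC 0;; CFor 5 (EV 0) (CFor 6 (EV 0) (CFor 7 (EV 0) Test3)).

Definition Toggle : com :=
  13 ::= EGet 2 (EC 0) (EV 12);;
  CIf (EV 13)
    (CIf (ESub (EV 13) (EC 1)) (20 ::= EV 9;; 21 ::= EV 11)
                               (20 ::= EV 10;; 21 ::= EV 11))
    (20 ::= EV 9;; 21 ::= EV 10);;
  CPut 1 (EV 20) (EV 21) (ESub (EC 1) (EGet 1 (EV 20) (EV 21)));;
  CPut 1 (EV 21) (EV 20) (EGet 1 (EV 20) (EV 21));;
  12 ::= EAdd (EV 12) (EC 1).

Definition Phase1 : com :=
  12 ::= EC 0;; CFor 18 (EV 1) (Find3;; CIf (EV 8) Toggle CSkip).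

Definition CopyMatrix : com :=
  CFor 5 (EV 0) (CFor 6 (EV 0) (CPut 1 (EV 5) (EV 6) (EGet 0 (EV 5) (EV 6)))).

Definition Degree : com :=
  22 ::= EC 1;;
  CFor 6 (EV 0) (CIf (EGet 1 (EV 5) (EV 6)) (22 ::= EAdd (EV 22) (EC 1)) CSkip).

(** The array still holds the profile left by the preceding string, so cells 1 to [cap] are erased
    before counting. *)
Definition InitProfile : com :=
  CFor 22 ECap (CPut 3 (EC 0) (EAdd (EV 22) (EC 1)) (EC 0));;
  CFor 5 (EV 0) (Degree;;
    CPut 3 (EC 0) (EV 22) (EAdd (EGet 3 (EC 0) (EV 22)) (EC 1))).

Definition Cost : com :=
  CFor 5 (EV 14) (CFor 6 (EV 15) (16 ::= EAdd (EV 16) (EC 1))).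

Definition TakeN (x : nat) : com :=
  CIf (ESub (EV x) (EGet 3 (EC 0) (EV x))) (17 ::= EC 1) CSkip;;
  CPut 3 (EC 0) (EV x) (ESub (EGet 3 (EC 0) (EV x)) (EV x)).

Definition GiveN (x : nat) : com :=
  CPut 3 (EC 0) (EV x) (EAdd (EGet 3 (EC 0) (EV x)) (EV x)).

Definition Split : com :=
  Cost;; 22 ::= EAdd (EV 14) (EV 15);;
  TakeN 22;; GiveN 14;; GiveN 15;; 14 ::= EC 1;; 15 ::= EC 1.

Definition Merge : com :=
  Cost;; 22 ::= EAdd (EV 14) (EV 15);;
  TakeN 14;; TakeN 15;; GiveN 22;; 14 ::= EC 1;; 15 ::= EC 1.

Definition Step2 : com :=
  13 ::= EGet 2 (EC 0) (EAdd (EV 12) (EV 18));;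
  CIf (EV 13)
    (CIf (ESub (EV 13) (EC 1))
      (CIf (ESub (EV 13) (EC 2)) (15 ::= EAdd (EV 15) (EC 1))
                                 (14 ::= EAdd (EV 14) (EC 1)))
      Merge)
    Split.

Definition Phase2 : com :=
  14 ::= EC 1;; 15 ::= EC 1;; 16 ::= EV 12;; 17 ::= EC 0;;
  CFor 18 (ESub (EV 1) (EV 12)) Step2.

Definition Verdict : com :=
  Find3;;
  CFor 5 ECap (CFor 6 ECap
    (CIf (EGet 3 (EC 0) (EAdd (EV 5) (EC 1)))
      (CIf (EGet 3 (EC 0) (EAdd (EV 6) (EC 1)))
        (CIf (ESub (ESub (EV 5) (EV 6)) (EV 2)) (17 ::= EC 1) CSkip)
        CSkip)
      CSkip));;
  CIf (EV 8) CSkip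
    (CIf (EV 17) CSkip (CIf (ESub (EV 16) (EV 1)) CSkip (3 ::= EC 1))).

(** A base 4 counter with the least significant digit first. A carry that survives all [k] digits
    means that every string has been tried, and clears the loop flag. *)
Definition Next : com :=
  19 ::= EC 1;;
  CFor 18 (EV 1)
    (CIf (EV 19)
      (CIf (ESub (EC 3) (EGet 2 (EC 0) (EV 18)))
        (CPut 2 (EC 0) (EV 18) (EAdd (EGet 2 (EC 0) (EV 18)) (EC 1));; 19 ::= EC 0)
        (CPut 2 (EC 0) (EV 18) (EC 0)))
      CSkip);;
  CIf (EV 19) (4 ::= EC 0) CSkip.

Definition Body : com :=
  CopyMatrix;; Phase1;; InitProfile;; Phase2;; Verdict;; Next.

Ltac frv F x := rewrite (proj1 F x isT).
Ltac fra F a := rewrite (fun i j => proj2 F a i j isT).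

Section Algorithm.
Variables (W cap : nat) (inp : nat -> nat) (n k eta : nat).
Hypothesis capP : n + k + 2 <= cap.
Notation run := (run W cap inp).
Notation eval := (eval W cap inp).

Definition mrep (b : nat) (s : store) (a : nat -> nat -> bool) : Prop :=
  forall i j, i < n -> j < n -> ar s b i j = a i j.

Definition enc3 (s : store) (r : option (nat * nat * nat)) : Prop :=
  if r is Some (u, v, w) then
    [/\ vr s 8 = 1, vr s 9 = u, vr s 10 = v & vr s 11 = w]
  else vr s 8 = 0.

Lemma run_seq c1 c2 s : run (c1;; c2) s = run c2 (run c1 s).
Proof. by []. Qed.

Lemma run_if e c1 c2 s :
  run (CIf e c1 c2) s = if eval s e == 0 then run c2 s else run c1 s.
Proof. by []. Qed.

(** The innermost test adds the truncated differences [i - l] and [l - i], whose sum is non-zero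
    exactly when [i] and [l] differ. *)
Lemma test3P s a r i j l : vr s 5 = i -> vr s 6 = j -> vr s 7 = l ->
  i < n -> j < n -> l < n -> mrep 1 s a -> enc3 s r ->
  enc3 (run Test3 s) (if P3 a i j l then Some (i, j, l) else r).
Proof.
move=> e5 e6 e7 li lj ll ma er; rewrite /= e5 e6 e7 !(minn_idPl _); try lia.
rewrite !ma // !eqb0 /P3; case: (a i j) => //=; case: (a j l) => //=.
case: (a i l) => //=; case: (eqVneq i l) => [->|il] /=.
  by rewrite subnn.
by rewrite (_ : (_ + _ == 0) = false) /= ?e5 ?e6 ?e7 //; lia.
Qed.

Lemma find3P s a : vr s 0 = n -> mrep 1 s a -> enc3 (run Find3 s) (find3 n a).
Proof.
move=> en ma; rewrite run_seq; set s0 := run _ s.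
have e0 : vr s0 0 = n by [].
have m0 : mrep 1 s0 a by [].
have nc : minn n cap = n by lia.
pose F3 i j := fun l r => if P3 a i j l then Some (i, j, l) else r.
pose F2 i := fun j r => iteri n (F3 i j) r.
pose F1 := fun i r => iteri n (F2 i) r.
apply: (@run_for W cap inp 5 (EV 0) _ s0 n
  (fun i s => enc3 s (iteri i F1 None))) => //; first by rewrite [eval _ _]e0.
move=> i s1 li fr1 er1.
set s2 := setv s1 5 i.
have e2 : vr s2 0 = n by rewrite /=; frv fr1 0.
have m2 : mrep 1 s2 a by move=> x y lx ly; rewrite /=; fra fr1 1; exact: m0.
apply: (@run_for W cap inp 6 (EV 0) _ s2 n
  (fun j s => enc3 s (iteri j (F2 i) (iteri i F1 None)))) => //.
  by rewrite [eval _ _]e2.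
move=> j s3 lj fr3 er3.
set s4 := setv s3 6 j.
have e4 : vr s4 0 = n by rewrite /=; frv fr3 0.
have e45 : vr s4 5 = i by rewrite /=; frv fr3 5.
have m4 : mrep 1 s4 a by move=> x y lx ly; rewrite /=; fra fr3 1; exact: m2.
apply: (@run_for W cap inp 7 (EV 0) _ s4 n
  (fun l s => enc3 s (iteri l (F3 i j) (iteri j (F2 i) (iteri i F1 None))))) => //.
  by rewrite [eval _ _]e4.
move=> l s5 ll fr5 er5.
rewrite iteriS; apply: test3P => //.
- by rewrite /=; frv fr5 5.
- by rewrite /=; frv fr5 6.
- by move=> x y lx ly; rewrite /=; fra fr5 1; exact: m4.
Qed.

Lemma toggleP s a t d : vr s 12 < k -> ar s 2 0 (vr s 12) = d ->
  good n a -> mrep 1 s a -> find3 n a = Some t -> enc3 s (Some t) ->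
  mrep 1 (run Toggle s) (pick3 a t d) /\ vr (run Toggle s) 12 = (vr s 12).+1.
Proof.
case: t => [[u v] w] lp ed ga ma /find3_some h3 [e8 e9 e10 e11].
have [[lu lv lw] [uv vw uw]] := P3_lt ga h3; have [sy _ _] := ga.
rewrite /Toggle run_seq; set s1 := run _ s.
have e13 : vr s1 13 = d by rewrite /= min0n (minn_idPl _) //; lia.
have ma1 : mrep 1 s1 a by exact: ma.
have p1 : vr s1 12 = vr s 12 by [].
have {e9} e9 : vr s1 9 = u by exact: e9.
have {e10} e10 : vr s1 10 = v by exact: e10.
have {e11} e11 : vr s1 11 = w by exact: e11.
clearbody s1; rewrite run_seq !run_if [eval _ (EV 13)]/= [eval _ (ESub _ _)]/= e13.
have [x [y [lx ly xy -> E]]] : exists x y, [/\ x < n, y < n, x != y,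
    pick3 a (u, v, w) d = tog a x y &
    (if d == 0 then run (20 ::= EV 9;; 21 ::= EV 10) s1
     else if d - 1 == 0 then run (20 ::= EV 10;; 21 ::= EV 11) s1
     else run (20 ::= EV 9;; 21 ::= EV 11) s1) = setv (setv s1 20 x) 21 y].
  by case: d {e13 ed} => [|[|d]]; [exists u, v|exists v, w|exists u, w];
    split=> //=; rewrite ?e9 ?e10 ?e11.
rewrite E; set s2 := setv _ 21 y.
rewrite /= !(minn_idPl _); try lia.
split; last by rewrite p1 addn1; lia.
move=> i j li lj /=.
rewrite /tog; have nyx : y != x by rewrite eq_sym.
case: (eqVneq i y) => [->|iy] /=; case: (eqVneq j x) => [->|jx] /=.
- by rewrite !eqxx /= ma1 // sy orbT addbT; case: (a y x).
- by rewrite (negbTE nyx) /= ma1 // addbF.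
- by rewrite (negbTE xy) andbF ma1 //= addbF.
- case: (eqVneq i x) => [->|ix] /=; last by rewrite ma1 // addbF.
  case: (eqVneq j y) => [->|jy] /=; last by rewrite ma1 // addbF.
  by rewrite ma1 // addbT; case: (a x y).
Qed.

Lemma phase1P s a ds : vr s 0 = n -> vr s 1 = k -> size ds = k ->
  (forall r, r < k -> ar s 2 0 r = nth 0 ds r) -> good n a -> mrep 1 s a ->
  let s' := run Phase1 s in
  [/\ mrep 1 s' (ph1 n ds a).1, vr s' 12 <= k & (ph1 n ds a).2 = drop (vr s' 12) ds].
Proof.
move=> e0 e1 sz eD ga ma s'; rewrite {}/s' run_seq; set s0 := run _ s.
(* The program always makes [k] rounds and idles once no path is left. Hence the last clause: either
   the graph is already free of paths, or every round so far has consumed a digit. *)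
pose I r (s' : store) := exists a1, [/\ good n a1, mrep 1 s' a1, vr s' 12 <= r,
  ph1 n (drop (vr s' 12) ds) a1 = ph1 n ds a & find3 n a1 = None \/ vr s' 12 = r].
have : I k (run (CFor 18 (EV 1) (Find3;; CIf (EV 8) Toggle CSkip)) s0).
  apply: run_for; first by rewrite [eval _ _]e1 (minn_idPl _) //; lia.
    by exists a; split=> //=; [rewrite drop0 | right].
  move=> r s1 lr fr [a1 [ga1 ma1 pr pe fd]].
  rewrite run_seq; set s2 := run Find3 _.
  have F2 : frame Find3 (setv s1 18 r) s2 by apply: frame_run.
  have en2 : enc3 s2 (find3 n a1).
    by apply: find3P => //=; frv fr 0.
  have m2 : mrep 1 s2 a1 by move=> x y lx ly; fra F2 1; apply: ma1.
  have p2 : vr s2 12 = vr s1 12 by frv F2 12.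
  rewrite run_if [eval _ _]/=; case ef: (find3 n a1) en2 fd => [[[u v] w]|].
    case=> e8 e9 e10 e11 [//|pr']; rewrite e8 [1 == 0]/=.
    have [|||mt pt] := @toggleP s2 a1 (u, v, w) (nth 0 ds r) _ _ ga1 m2 ef.
    - by rewrite p2 pr'.
    - rewrite p2 pr'; fra F2 2; rewrite /=; fra fr 2; rewrite /= eD //.
    - by split.
    exists (pick3 a1 (u, v, w) (nth 0 ds r)); split=> //.
    - exact: good_pick3 ga1 (find3_some ef).
    - by rewrite pt p2 pr'.
    - by rewrite pt p2 pr' -pe pr' [in RHS](drop_nth 0) ?sz //= ef.
    - by right; rewrite pt p2 pr'.
  rewrite /enc3 => e8 _; rewrite e8 [run _ _]/=; exists a1; split=> //.
  - by rewrite p2; apply: leqW.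
  - by rewrite p2.
  - by left.
case=> a1 [ga1 ma1 pk pe fd]; rewrite -pe.
case: fd => [fd|pk'].
  have hp d : ph1 n d a1 = (a1, d) by case: d => [|? ?] /=; rewrite fd.
  by rewrite hp.
rewrite pk' drop_oversize ?sz //=.
by case: (find3 n a1) => [t|].
Qed.

Lemma copyP s a : vr s 0 = n -> mrep 0 s a -> mrep 1 (run CopyMatrix s) a.
Proof.
move=> e0 ma; have nc : minn n cap = n by lia.
apply: (@run_for W cap inp 5 (EV 0) _ s n
  (fun i s => forall x y, x < i -> y < n -> ar s 1 x y = a x y)) => //=.
  by rewrite e0.
move=> i s1 li fr I1.
have [|||h1 h2] := @run_for W cap inp 6 (EV 0)
  (CPut 1 (EV 5) (EV 6) (EGet 0 (EV 5) (EV 6))) (setv s1 5 i) n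
  (fun j s => (forall x y, x < i -> y < n -> ar s 1 x y = a x y) /\
      (forall y, y < j -> ar s 1 i y = a i y)); [|by split| |].
- by rewrite /= (proj1 fr 0 isT) e0.
- move=> j s2 lj fr2 [J1 J2]; rewrite /= (proj1 fr2 5 isT) /= !(minn_idPl _); try lia.
  split=> [x y lx ly|y ly] /=.
    by rewrite (_ : (x == i) = false) /= ?J1 //; lia.
  rewrite eqxx /=; case: (eqVneq y j) => [->|yj]; last by apply: J2; lia.
  by fra fr2 0; rewrite /=; fra fr 0; apply: ma.
move=> x y; rewrite ltnS leq_eqVlt => /orP[/eqP ->|lx] ly; first exact: h2.
exact: h1.
Qed.

Lemma degreeP s a i : vr s 0 = n -> vr s 5 = i -> i < n -> mrep 1 s a ->
  vr (run Degree s) 22 = dg n a i.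
Proof.
move=> e0 e5 li ma; rewrite run_seq; set s0 := run _ s.
have -> : dg n a i = 1 + \sum_(x < n) a i x by [].
apply: (@run_for W cap inp 6 (EV 0) _ s0 n
  (fun j s => vr s 22 = 1 + \sum_(x < j) a i x)).
- by rewrite [eval _ _]e0; lia.
- by rewrite big_ord0.
move=> j s1 lj fr e22; rewrite run_if [eval _ _]/= (proj1 fr 5 isT) [vr s0 5]e5.
rewrite !(minn_idPl _); try lia.
rewrite (proj2 fr 1 i j isT) [ar s0 1 i j]ma // eqb0 big_ord_recr /=.
have le : \sum_(x < j) a i x <= j.
  rewrite -[X in _ <= X]card_ord -sum1_card; apply: leq_sum => x _.
  by case: (a i x).
by move: le e22; set S := \sum_(x < j) _ => le e22; case: (a i j); rewrite /= e22; lia.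
Qed.

Definition nrep (s : store) (N : nat -> nat) : Prop :=
  forall x, 0 < x <= cap -> ar s 3 0 x = N x.

Lemma initProfileP s a : vr s 0 = n -> mrep 1 s a ->
  nrep (run InitProfile s) (prof0 n a).
Proof.
move=> e0 ma; rewrite run_seq; set s0 := run _ s.
have z0 x : 0 < x <= cap -> ar s0 3 0 x = 0.
  suff h : forall y, 0 < y <= cap -> ar s0 3 0 y = 0 by exact: h.
  apply: (@run_for W cap inp 22 ECap _ s cap
    (fun i s => forall y, 0 < y <= i -> ar s 3 0 y = 0)); first exact: minnn.
    by move=> y; lia.
  move=> i s1 li fr I1 y hy; rewrite /= min0n !(minn_idPl _) /=; try lia.
  by case: eqP => // ne; apply: I1; lia.
have F0 : frame (CFor 22 ECap (CPut 3 (EC 0) (EAdd (EV 22) (EC 1)) (EC 0))) s s0.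
  exact: frame_run.
have {e0} e0 : vr s0 0 = n by frv F0 0.
have {ma} ma : mrep 1 s0 a by move=> x y lx ly; fra F0 1; exact: ma.
clearbody s0.
apply: (@run_for W cap inp 5 (EV 0) _ s0 n
    (fun i s => forall x, 0 < x <= cap -> ar s 3 0 x = \sum_(y < i) (dg n a y == x))).
- by rewrite [eval _ _]e0; lia.
- by move=> x hx; rewrite big_ord0 z0.
move=> i s1 li fr I1 x hx; rewrite run_seq.
set s2 := run Degree _.
have F2 : frame Degree (setv s1 5 i) s2 by apply: frame_run.
have e22 : vr s2 22 = dg n a i.
  apply: degreeP => //=; first by frv fr 0.
  by move=> u v lu lv; rewrite /=; fra fr 1; exact: ma.
have dle : dg n a i <= n.+1.
  rewrite /dg add1n ltnS -[X in _ <= X]card_ord -sum1_card; apply: leq_sum => y _.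
  by case: (a i y).
have dr : 0 < dg n a i <= cap.
  by rewrite (leq_trans dle) ?andbT; [rewrite /dg add1n | lia].
rewrite big_ord_recr /= min0n e22 !(minn_idPl _) /=; try lia; last first.
  fra F2 3; rewrite /= I1 //.
  have : \sum_(y < i) (dg n a y == dg n a i) <= i.
    rewrite -[X in _ <= X]card_ord -sum1_card; apply: leq_sum => y _.
    by case: (_ == _).
  by move=> h; rewrite addn1; apply: leq_ltn_trans h _; lia.
case: (eqVneq x (dg n a i)) => [->|ne].
  by fra F2 3; rewrite /= I1.
by fra F2 3; rewrite /= I1 // addn0.
Qed.

(** Guarantees that sizes used as array indices are positive and not truncated, so program and model
    address the same entries. *)
Definition wfst (st : rst) : Prop :=
  [/\ 0 < rp st <= cap, 0 < rq st <= cap & rc st <= cap].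

Lemma step2_wf st d : wfst st -> wfst (step2 cap st d).
Proof.
case: st => N p q c b [/= h1 h2 h3].
by case: d => [|[|[|d]]]; split=> /=; rewrite ?/cadd; lia.
Qed.

Definition srep (s : store) (st : rst) : Prop :=
  [/\ nrep s (rN st), vr s 14 = rp st, vr s 15 = rq st, vr s 16 = rc st &
      vr s 17 = rb st].

Lemma costP s p q c : vr s 14 = p -> vr s 15 = q -> vr s 16 = c ->
  p <= cap -> q <= cap -> c <= cap ->
  vr (run Cost s) 16 = cadd cap c (p * q).
Proof.
move=> e14 e15 e16 hp hq hc.
apply: (@run_for W cap inp 5 (EV 14) _ s p
    (fun i s => vr s 16 = cadd cap c (i * q))).
- by rewrite [eval _ _]e14; lia.
- by rewrite /cadd; lia.
move=> i s1 li fr I1.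
have -> : cadd cap c (i.+1 * q) = cadd cap c (i * q + q) by rewrite mulSn addnC.
apply: (@run_for W cap inp 6 (EV 15) _ (setv s1 5 i) q
    (fun j s => vr s 16 = cadd cap c (i * q + j))).
- by rewrite /= (proj1 fr 15 isT) e15; lia.
- by rewrite /= I1 addn0.
by move=> j s2 lj fr2 J1; rewrite /= J1 /cadd; lia.
Qed.

Lemma takeP s N x v (b : bool) : eqn x 17 = false -> vr s x = v -> 0 < v <= cap ->
  nrep s N -> vr s 17 = b ->
  nrep (run (TakeN x) s) (updf N v (N v - v)) /\
  vr (run (TakeN x) s) 17 = b || (N v < v).
Proof.
move=> x17 ex hv hN eb; rewrite /TakeN run_seq run_if.
have -> : eval s (ESub (EV x) (EGet 3 (EC 0) (EV x))) = v - N v.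
  by rewrite /= ex min0n (minn_idPl _) ?hN //; lia.
set s' := if _ then _ else _.
have ex' : vr s' x = v by rewrite /s'; case: ifP => _ //=; rewrite x17.
have hN' : nrep s' N by move=> y hy; rewrite /s'; case: ifP => _ /=; apply: hN.
split=> [y hy|] /=.
  by rewrite min0n ex' (minn_idPl _) ?hN' // ?/updf; lia.
rewrite /s' subn_eq0 leqNgt; case: ltnP => /= _; first by rewrite orbT.
by rewrite orbF.
Qed.

Lemma giveP s N x v : vr s x = v -> 0 < v <= cap -> nrep s N ->
  nrep (run (GiveN x) s) (updf N v (cadd cap (N v) v)).
Proof.
move=> ex hv hN y hy /=.
by rewrite min0n ex (minn_idPl _) ?hN // ?/updf //; lia.
Qed.

Lemma splitP s1 st : srep s1 st -> wfst st -> srep (run Split s1) (step2 cap st 0).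
Proof.
case: st => N p q c b [hN e14 e15 e16 e17] [hp hq hc].
have {hN} hN : nrep s1 N by exact: hN.
have {e14} e14 : vr s1 14 = p by exact: e14.
have {e15} e15 : vr s1 15 = q by exact: e15.
have {e16} e16 : vr s1 16 = c by exact: e16.
have {e17} e17 : vr s1 17 = b by exact: e17.
have {hp} hp : 0 < p <= cap by exact: hp.
have {hq} hq : 0 < q <= cap by exact: hq.
have {hc} hc : c <= cap by exact: hc.
have hs : 0 < cadd cap p q <= cap by rewrite /cadd; lia.
have F2 := frame_run W cap inp Cost s1.
have C2 : vr (run Cost s1) 16 = cadd cap c (p * q) by apply: costP => //; lia.
rewrite run_seq.
set s2 := run Cost s1 in F2 C2 *.
have p2 : vr s2 14 = p by frv F2 14.
have q2 : vr s2 15 = q by frv F2 15.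
have b2 : vr s2 17 = b by frv F2 17.
have N2 : nrep s2 N by move=> y hy; fra F2 3; exact: hN.
clearbody s2; rewrite run_seq; set s3 := run _ s2.
have e22 : vr s3 22 = cadd cap p q by rewrite /= p2 q2.
have F4 := frame_run W cap inp (TakeN 22) s3.
have [N4 b4] := takeP (x := 22) erefl e22 hs (N2 : nrep s3 N) (b2 : vr s3 17 = b).
rewrite run_seq; set s4 := run _ s3 in F4 N4 b4 *.
have p4 : vr s4 14 = p by frv F4 14.
have q4 : vr s4 15 = q by frv F4 15.
have c4 : vr s4 16 = cadd cap c (p * q) by frv F4 16.
clearbody s4; rewrite run_seq.
have N5 := giveP p4 hp N4; set s5 := run _ s4 in N5 *.
rewrite run_seq; have N6 := giveP (q4 : vr s5 15 = q) hq N5.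
set s6 := run _ s5 in N6 *.
by split=> //; rewrite /= b4.
Qed.

Lemma mergeP s1 st : srep s1 st -> wfst st -> srep (run Merge s1) (step2 cap st 1).
Proof.
case: st => N p q c b [hN e14 e15 e16 e17] [hp hq hc].
have {hN} hN : nrep s1 N by exact: hN.
have {e14} e14 : vr s1 14 = p by exact: e14.
have {e15} e15 : vr s1 15 = q by exact: e15.
have {e16} e16 : vr s1 16 = c by exact: e16.
have {e17} e17 : vr s1 17 = b by exact: e17.
have {hp} hp : 0 < p <= cap by exact: hp.
have {hq} hq : 0 < q <= cap by exact: hq.
have {hc} hc : c <= cap by exact: hc.
have hs : 0 < cadd cap p q <= cap by rewrite /cadd; lia.
have F2 := frame_run W cap inp Cost s1.
have C2 : vr (run Cost s1) 16 = cadd cap c (p * q) by apply: costP => //; lia.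
rewrite run_seq.
set s2 := run Cost s1 in F2 C2 *.
have p2 : vr s2 14 = p by frv F2 14.
have q2 : vr s2 15 = q by frv F2 15.
have b2 : vr s2 17 = b by frv F2 17.
have N2 : nrep s2 N by move=> y hy; fra F2 3; exact: hN.
clearbody s2; rewrite run_seq; set s3 := run _ s2.
have e22 : vr s3 22 = cadd cap p q by rewrite /= p2 q2.
have F4 := frame_run W cap inp (TakeN 14) s3.
have [N4 b4] := takeP (x := 14) erefl (p2 : vr s3 14 = p) hp (N2 : nrep s3 N)
  (b2 : vr s3 17 = b).
rewrite run_seq; set s4 := run _ s3 in F4 N4 b4 *.
have q4 : vr s4 15 = q by frv F4 15.
have F5 := frame_run W cap inp (TakeN 15) s4.
have [N5 b5] := takeP (x := 15) erefl q4 hq N4 b4.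
rewrite run_seq; set s5 := run _ s4 in F5 N5 b5 *.
have e5 : vr s5 22 = cadd cap p q by frv F5 22; frv F4 22.
have c5 : vr s5 16 = cadd cap c (p * q) by frv F5 16; frv F4 16.
clearbody s5; rewrite run_seq; have N6 := giveP e5 hs N5.
set s6 := run _ s5 in N6 *.
by split=> //; rewrite /= b5 orbA.
Qed.

Lemma step2P s st d : srep s st -> wfst st -> vr s 12 + vr s 18 <= cap ->
  ar s 2 0 (vr s 12 + vr s 18) = d -> srep (run Step2 s) (step2 cap st d).
Proof.
move=> Hs Hw hi hd; rewrite /Step2 run_seq; set s1 := run _ s.
have e13 : vr s1 13 = d by rewrite /= min0n !(minn_idPl _).
have {}Hs : srep s1 st by exact: Hs.
clearbody s1; clear hi hd s.
rewrite !run_if [eval _ (EV 13)]/= ![eval _ (ESub _ _)]/= e13.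
case: d {e13} => [|[|[|d]]].
- exact: splitP.
- exact: mergeP.
- by case: st Hs {Hw} => N p q c b [h1 h2 h3 h4 h5]; split=> //=; rewrite h2.
- by case: st Hs {Hw} => N p q c b [h1 h2 h3 h4 h5]; split=> //=; rewrite h3.
Qed.

Lemma phase2P s a ds : vr s 1 = k -> vr s 12 <= k -> size ds = k ->
  (forall r, r < k -> ar s 2 0 r = nth 0 ds r) -> nrep s (prof0 n a) ->
  srep (run Phase2 s) (foldl (step2 cap) (init2 n a (vr s 12)) (drop (vr s 12) ds)).
Proof.
move=> e1 hp sz eD hN; rewrite /Phase2 !run_seq; set s0 := run (17 ::= EC 0) _.
set rest := drop _ ds.
have szr : size rest = k - vr s 12 by rewrite size_drop sz.
pose st r := foldl (step2 cap) (init2 n a (vr s 12)) (take r rest).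
have -> : foldl (step2 cap) (init2 n a (vr s 12)) rest = st (k - vr s 12).
  by rewrite /st -szr take_size.
suff [] : srep (run (CFor 18 (ESub (EV 1) (EV 12)) Step2) s0) (st (k - vr s 12)) /\
  wfst (st (k - vr s 12)) by [].
apply: (@run_for W cap inp 18 _ _ s0 (k - vr s 12)
  (fun r s => srep s (st r) /\ wfst (st r))).
- by rewrite /= e1; lia.
- rewrite /st take0; split; split=> //=; lia.
move=> r s1 lr fr [I1 I2].
have -> : st r.+1 = step2 cap (st r) (nth 0 rest r).
  by rewrite /st (take_nth 0) ?szr // foldl_rcons.
split; last exact: step2_wf.
have e12 : vr s1 12 = vr s 12 by frv fr 12.
apply: step2P => //=; rewrite e12; first by lia.
by fra fr 2; rewrite /= eD ?nth_drop //; lia.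
Qed.

Lemma all_iotaS (P : pred nat) i : all P (iota 0 i.+1) = all P (iota 0 i) && P i.
Proof. by rewrite -addn1 iotaD all_cat /= andbT. Qed.

Lemma checkP s a st (x : bool) : vr s 0 = n -> vr s 1 = k -> vr s 2 = eta ->
  mrep 1 s a -> srep s st -> vr s 3 = x ->
  vr (run Verdict s) 3 =
  x || [&& find3 n a == None, ~~ rb st, rc st <= k & balb eta cap (rN st)].
Proof.
move=> e0 e1 e2 ma [hN _ _ e16 e17] e3; rewrite /Verdict run_seq.
have E8 := find3P e0 ma; have F := frame_run W cap inp Find3 s.
set s1 := run Find3 s in E8 F *.
have {e1} e1 : vr s1 1 = k by frv F 1.
have {e2} e2 : vr s1 2 = eta by frv F 2.
have {e3} e3 : vr s1 3 = x by frv F 3.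
have {e16} e16 : vr s1 16 = rc st by frv F 16.
have {e17} e17 : vr s1 17 = rb st by frv F 17.
have {hN} hN : nrep s1 (rN st) by move=> y hy; fra F 3; exact: hN.
clearbody s1; rewrite run_seq.
pose T s t := [|| rN st s.+1 == 0, rN st t.+1 == 0 | s - t <= eta].
set L := CFor 5 _ _; have F1 := frame_run W cap inp L s1.
have B1 : vr (run L s1) 17 = rb st || ~~ balb eta cap (rN st).
  apply: (@run_for W cap inp 5 ECap _ s1 cap
    (fun i s => vr s 17 = rb st || ~~ all (fun u => all (T u) (iota 0 cap)) (iota 0 i))).
  - exact: minnn.
  - by rewrite orbF.
  move=> i s2 li fr I1; rewrite all_iotaS negb_and orbA.
  set b1 := _ || _ in I1 *.
  apply: (@run_for W cap inp 6 ECap _ (setv s2 5 i) cap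
    (fun j s => vr s 17 = b1 || ~~ all (T i) (iota 0 j))).
  - exact: minnn.
  - by rewrite orbF.
  move=> j s3 lj fr3 J1; rewrite all_iotaS negb_and orbA.
  set b2 := _ || _ in J1 *.
  have n3 y : 0 < y <= cap -> ar s3 3 0 y = rN st y.
    by move=> hy; fra fr3 3; rewrite /=; fra fr 3; exact: hN.
  rewrite /= min0n (proj1 fr3 5 isT) (proj1 fr3 2 isT) /= (proj1 fr 2 isT) e2.
  rewrite !(minn_idPl _); try lia.
  rewrite !addn1 !n3; try lia.
  rewrite /T subn_eq0; case: (rN st i.+1 == 0) => /=; first by rewrite J1 orbF.
  case: (rN st j.+1 == 0) => /=; first by rewrite J1 orbF.
  by case: (i - j <= eta) => /=; rewrite ?J1 ?orbF ?orbT.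
set s2 := run L s1 in F1 B1 *.
have e8 : vr s2 8 = (find3 n a != None).
  by frv F1 8; case: (find3 n a) E8 => [[[u v] w] []|].
rewrite !run_if [eval _ (EV 8)]/= [eval _ (EV 17)]/= [eval _ (ESub _ _)]/=.
rewrite B1 e8 (proj1 F1 16 isT) (proj1 F1 1 isT) e16 e1 !eqb0 subn_eq0.
have e3' : vr s2 3 = x by frv F1 3.
case: (find3 n a == None) => /=; last by rewrite e3' orbF.
rewrite negb_or negbK; case: (rb st) => /=; first by rewrite e3' orbF.
case: (balb _ _ _) => /=; last by rewrite andbF e3' orbF.
by rewrite andbT; case: (_ <= k) => /=; rewrite ?orbT ?orbF.
Qed.

(** * Counting through the digit strings in base 4 *)

Definition dig v r : nat := (v %/ 4 ^ r) %% 4.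

(** The divisibility says that the carry reaches digit [i]. With [w.+1] the quotient of [v.+1] by
    [4 ^ i], the lower digits of [v] are all 3 and [v] divided by [4 ^ i] is [w]. *)
Lemma dig_succ_dvd v i : 4 ^ i %| v.+1 ->
  exists w, [/\ dig v.+1 i = w.+1 %% 4, dig v i = w %% 4 &
                (4 ^ i.+1 %| v.+1) = (4 %| w.+1)].
Proof.
have p4 : 0 < 4 ^ i by rewrite expn_gt0.
move=> /dvdnP[[|w] e] //; exists w; split; rewrite /dig.
- by rewrite e mulnK.
- have -> : v = w * 4 ^ i + (4 ^ i).-1 by lia.
  by rewrite divnMDl // divn_small ?addn0 // prednK.
- by rewrite e expnS dvdn_pmul2r.
Qed.

Lemma dig_succ_ndvd v i : ~~ (4 ^ i %| v.+1) -> dig v.+1 i = dig v i.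
Proof.
have p4 : 0 < 4 ^ i by rewrite expn_gt0.
rewrite /dvdn -lt0n => h; rewrite /dig; congr (_ %% 4).
have lt := ltn_pmod v.+1 p4.
rewrite [in RHS](_ : v = v.+1 %/ 4 ^ i * 4 ^ i + (v.+1 %% 4 ^ i).-1); last first.
  by have := divn_eq v.+1 (4 ^ i); lia.
by rewrite divnMDl // [X in _ = _ + X]divn_small ?addn0 //; lia.
Qed.

Lemma nextP s v : v < 4 ^ k -> vr s 1 = k ->
  (forall r, r < k -> ar s 2 0 r = dig v r) ->
  (forall r, r < k -> ar (run Next s) 2 0 r = dig v.+1 r) /\
  vr (run Next s) 4 = if v.+1 == 4 ^ k then 0 else vr s 4.
Proof.
move=> lv e1 eD; rewrite /Next run_seq; set s0 := run _ s.
rewrite run_seq; set L := CFor 18 _ _; have F := frame_run W cap inp L s0.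
(* The vacuous range from [k] to [k] is the loop invariant at its last index: digits already passed
   are those of [v.+1], the others those of [v]. *)
have [[H1 _] H2] : ((forall r, r < k -> ar (run L s0) 2 0 r = dig v.+1 r) /\
    (forall r, k <= r < k -> ar (run L s0) 2 0 r = dig v r)) /\
    vr (run L s0) 19 = (4 ^ k %| v.+1).
  apply: (@run_for W cap inp 18 _ _ s0 k (fun i s =>
    ((forall r, r < i -> ar s 2 0 r = dig v.+1 r) /\
     (forall r, i <= r < k -> ar s 2 0 r = dig v r)) /\
    vr s 19 = (4 ^ i %| v.+1))).
  - by rewrite /= e1; lia.
  - by rewrite expn0 dvd1n; split=> //; split=> // r hr; rewrite -eD.
  move=> i s1 li fr [[I1 I2] I3].
  have ei : ar s1 2 0 i = dig v i by apply: I2; lia.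
  rewrite !run_if [eval _ (EV 19)]/= [eval _ (ESub _ _)]/= min0n (minn_idPl _); last lia.
  rewrite I3 ei eqb0; case: ifPn => [nd|].
    split; last first.
      rewrite /= I3 (negbTE nd); apply/esym/eqP; rewrite eqb0.
      apply: contra nd => h; apply: dvdn_trans h.
      by rewrite expnS dvdn_mull.
    split=> r hr /=; last by apply: I2; lia.
    case: (eqVneq r i) => [->|ri]; last by apply: I1; lia.
    by rewrite ei dig_succ_ndvd.
  rewrite negbK => dv; have [w [d1 d2 d3]] := dig_succ_dvd dv.
  have lw : w %% 4 < 4 by rewrite ltn_mod.
  rewrite d2; case: ifPn => h; rewrite /= min0n !(minn_idPl _) ?ei ?d2; try lia.
    split; last by rewrite I3 dv d3; lia.
    split=> r hr /=.
      by case: eqP => [->|ri]; [rewrite d1; lia | apply: I1; lia].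
    by rewrite (_ : (r == i) = false); [apply: I2; lia | lia].
  split; last by rewrite d3; lia.
  split=> r hr /=.
    by case: eqP => [->|ri]; [rewrite d1; lia | apply: I1; lia].
  by rewrite (_ : (r == i) = false); [apply: I2; lia | lia].
rewrite run_if [eval _ _]/= H2 eqb0.
have -> : (v.+1 == 4 ^ k) = (4 ^ k %| v.+1).
  by apply/eqP/idP => [->|/dvdn_leq]; [| move=> /(_ isT); lia].
case: (4 ^ k %| v.+1); split=> //=; by frv F 4.
Qed.

Definition digs v : seq nat := mkseq (dig v) k.

Definition binv (s : store) (a : nat -> nat -> bool) v : Prop :=
  [/\ vr s 0 = n, vr s 1 = k, vr s 2 = eta, mrep 0 s a &
      forall r, r < k -> ar s 2 0 r = dig v r].

Lemma bodyP s a v (x : bool) : good n a -> v < 4 ^ k -> binv s a v ->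
  vr s 3 = x -> vr s 4 = 1 ->
  let s' := run Body s in
  [/\ binv s' a v.+1, vr s' 3 = x || acceptb n k eta cap (digs v) a &
      vr s' 4 = (v.+1 != 4 ^ k)].
Proof.
move=> ga lv [e0 e1 e2 m0 eD] e3 e4 s'; rewrite {}/s' /Body.
have sz : size (digs v) = k by rewrite size_mkseq.
have {}eD r : r < k -> ar s 2 0 r = nth 0 (digs v) r.
  by move=> lr; rewrite nth_mkseq ?eD.
have keep c t : frame c s t -> 0 \notin wvars c -> 1 \notin wvars c ->
   2 \notin wvars c -> 3 \notin wvars c -> 4 \notin wvars c ->
   0 \notin warrs c -> 2 \notin warrs c ->
   [/\ vr t 0 = n, vr t 1 = k, vr t 2 = eta, vr t 3 = x & vr t 4 = 1] /\
   (mrep 0 t a /\ forall r, r < k -> ar t 2 0 r = nth 0 (digs v) r).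
  move=> [fv fa] h0 h1 h2 h3 h4 a0 a2; rewrite !fv //; split=> //.
  by split=> [i j li lj|r lr]; rewrite fa //; [exact: m0 | exact: eD].
have F1 := frame_run W cap inp CopyMatrix s.
have M1 := copyP e0 m0.
rewrite run_seq; set s1 := run _ s in F1 M1 *.
have [[a0 a1 a2 a3 a4] [am aD]] := keep _ _ F1 isT isT isT isT isT isT isT.
have F2 := frame_run W cap inp Phase1 s1.
have [M2 P2 R2] := phase1P a0 a1 sz aD ga M1.
rewrite run_seq; set s2 := run _ s1 in F2 M2 P2 R2 *.
have F12 : frame (CopyMatrix;; Phase1) s s2 by apply: frame_run.
have [[b0 b1 b2 b3 b4] [bm bD]] := keep _ _ F12 isT isT isT isT isT isT isT.
have F3 := frame_run W cap inp InitProfile s2.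
have N3 := initProfileP b0 M2.
rewrite run_seq; set s3 := run _ s2 in F3 N3 *.
have F13 : frame (CopyMatrix;; Phase1;; InitProfile) s s3 by apply: frame_run.
have [[c0 c1 c2 c3 c4] [cm cD]] := keep _ _ F13 isT isT isT isT isT isT isT.
have p3 : vr s3 12 = vr s2 12 by frv F3 12.
have F4 := frame_run W cap inp Phase2 s3.
have P3' : vr s3 12 <= k by rewrite p3.
have S4 := phase2P c1 P3' sz cD N3.
rewrite p3 -R2 in S4.
rewrite run_seq; set s4 := run _ s3 in F4 S4 *.
have F14 : frame (CopyMatrix;; Phase1;; InitProfile;; Phase2) s s4 by apply: frame_run.
have [[d0 d1 d2 d3 d4] [dm dD]] := keep _ _ F14 isT isT isT isT isT isT isT.
have M4 : mrep 1 s4 (ph1 n (digs v) a).1.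
  by move=> i j li lj; fra F4 1; fra F3 1; exact: M2.
have C5 := checkP d0 d1 d2 M4 S4 d3.
have F5 := frame_run W cap inp Verdict s4.
rewrite run_seq; set s5 := run _ s4 in F5 C5 *.
have eD5 r : r < k -> ar s5 2 0 r = dig v r.
  by move=> lr; fra F5 2; rewrite dD // nth_mkseq.
have e51 : vr s5 1 = k by frv F5 1.
have [D6 G6] := nextP lv e51 eD5.
have F6 := frame_run W cap inp Next s5.
set s6 := run _ s5 in F6 D6 G6 *.
split.
- split=> //.
  + by frv F6 0; frv F5 0.
  + by frv F6 1.
  + by frv F6 2; frv F5 2.
  + by move=> i j li lj; fra F6 0; fra F5 0; exact: dm.
- frv F6 3; rewrite C5 /acceptb; congr (nat_of_bool (_ || _)).
  case: (ph1 n (digs v) a) R2 => a' rest /= ->.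
  by rewrite size_drop sz subKn.
- by rewrite G6; frv F5 4; rewrite d4; case: (_ == _).
Qed.

End Algorithm.

(** * Loading the input *)

Fixpoint Puts (c : nat) (bits : seq nat) : com :=
  if bits is b :: bits' then CPut 4 (EC 0) (EC c) (EC b);; Puts c.+1 bits' else CSkip.

(** Input cells below [W] have been overwritten by variables and temporaries, so their bits come
    from array 4, where [Puts] stored them; the cells from [W] on are read in place. *)
Definition LoadCell (W : nat) : com :=
  CIf (ESub (EC W) (EV 23))
    (CPut 0 (EV 5) (EV 6) (EGet 4 (EC 0) (EV 23)))
    (CPut 0 (EV 5) (EV 6) (EIn (EV 23)));;
  23 ::= EAdd (EV 23) (EC 1).

Definition LoadRow (W : nat) : com := CFor 6 (EV 0) (LoadCell W).

Definition LoadMatrix (W : nat) : com := 23 ::= EC 3;; CFor 5 (EV 0) (LoadRow W).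

Definition Clear : com := CFor 18 (EV 1) (CPut 2 (EC 0) (EV 18) (EC 0)).

Definition Setup (W : nat) (bits : seq nat) : com :=
  Puts 3 bits;; LoadMatrix W;; Clear;; 3 ::= EC 0;; 4 ::= EC 1.

Section SetupCorrect.
Variables (W cap : nat) (inp : nat -> nat) (n k eta : nat).
Hypothesis capP : W + 3 + n * n + k <= cap.
Hypothesis W3 : 3 <= W.
Notation run := (run W cap inp).
Notation eval := (eval W cap inp).

Lemma putsP bits c s y : c + size bits <= cap -> y <= cap ->
  ar (run (Puts c bits) s) 4 0 y =
  if c <= y < c + size bits then nth 0 bits (y - c) else ar s 4 0 y.
Proof.
elim: bits c s => [|b bits IH] c s /= hc hy; first by rewrite addn0 ltnNge andbN.
rewrite IH; [|lia|lia]; rewrite /= min0n (minn_idPl _); last lia.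
case: (ltngtP c y) => h.
- rewrite (_ : y < _ = (y < c + (size bits).+1)); last lia.
  by rewrite (_ : y - c = (y - c.+1).+1); last lia.
- by [].
- by rewrite h subnn /= (_ : (y < _)) //; lia.
Qed.

Lemma wvars_puts c bits : wvars (Puts c bits) = [::].
Proof. by elim: bits c => //= b bits IH c; rewrite IH. Qed.

Lemma loadP s (cell : nat -> nat) : vr s 0 = n ->
  (forall y, 3 <= y < W -> ar s 4 0 y = cell y) ->
  (forall y, W <= y < cap -> inp y = cell y) ->
  forall i j, i < n -> j < n -> ar (run (LoadMatrix W) s) 0 i j = cell (3 + (i * n + j)).
Proof.
move=> e0 hB hI; rewrite /LoadMatrix run_seq; set s0 := run _ s.
suff [h _] : (forall i j, i < n -> j < n ->
    ar (run (CFor 5 (EV 0) (LoadRow W)) s0) 0 i j = cell (3 + (i * n + j))) /\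
    vr (run (CFor 5 (EV 0) (LoadRow W)) s0) 23 = 3 + n * n by [].
apply: (@run_for W cap inp 5 _ _ s0 n (fun i s =>
  (forall x y, x < i -> y < n -> ar s 0 x y = cell (3 + (x * n + y))) /\
  vr s 23 = 3 + i * n)).
- by rewrite [eval _ _]e0 (minn_idPl _) //; nia.
- by split.
move=> i s1 li fr [I1 I2].
have nn : i * n + n <= n * n by rewrite -mulSnr leq_mul2r li orbT.
suff : ((forall x y, x < i -> y < n ->
    ar (run (LoadRow W) (setv s1 5 i)) 0 x y = cell (3 + (x * n + y))) /\
   (forall y, y < n ->
    ar (run (LoadRow W) (setv s1 5 i)) 0 i y = cell (3 + (i * n + y)))) /\
   vr (run (LoadRow W) (setv s1 5 i)) 23 = 3 + i * n + n.
  move=> [[h1 h2] h3]; split; last by rewrite h3 mulSnr addnA.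
  move=> x y; rewrite ltnS leq_eqVlt => /orP[/eqP ->|lx] ly; [exact: h2 | exact: h1].
apply: (@run_for W cap inp 6 _ _ (setv s1 5 i) n (fun j s =>
  ((forall x y, x < i -> y < n -> ar s 0 x y = cell (3 + (x * n + y))) /\
   (forall y, y < j -> ar s 0 i y = cell (3 + (i * n + y)))) /\
  vr s 23 = 3 + i * n + j)).
- by rewrite /= (proj1 fr 0 isT) [vr s0 0]e0 (minn_idPl _) //; nia.
- by split; [split | rewrite /= I2 addn0].
move=> j s2 lj fr2 [[J1 J2] J3].
set c := 3 + (i * n + j).
have cc : c < cap by rewrite /c; lia.
have c3 : 3 <= c by rewrite /c; lia.
have lin : i <= cap by nia.
have ljn : j <= cap by nia.
have e5 : vr s2 5 = i by frv fr2 5.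
rewrite /LoadCell run_seq run_if.
set s3 := if _ then _ else _.
have H0 x y : ar s3 0 x y = if (x == i) && (y == j) then cell c else ar s2 0 x y.
  rewrite /s3 /= J3 -addnA -/c; case: ifP => h /=; rewrite e5 !(minn_idPl _) //; try lia.
    by rewrite cc andbT (_ : W <= c) ?hI //; lia.
  by fra fr2 4; rewrite /=; fra fr 4; rewrite /= hB //; lia.
have H1 : vr s3 23 = 3 + i * n + j by rewrite /s3; case: ifP.
split; last by rewrite /= H1; lia.
split=> [x y lx ly|y ly] /=; rewrite H0.
  by rewrite (_ : (x == i) = false) /= ?J1 //; lia.
by rewrite eqxx /=; case: eqP => [->//|ne]; apply: J2; lia.
Qed.

Lemma clearP s : vr s 1 = k -> forall r, r < k -> ar (run Clear s) 2 0 r = 0.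
Proof.
move=> e1; apply: (@run_for W cap inp 18 _ _ s k (fun i s =>
  forall r, r < i -> ar s 2 0 r = 0)) => //.
  by rewrite [eval _ _]e1 (minn_idPl _) //; lia.
move=> i s1 li fr I1 r lr; rewrite /= min0n (minn_idPl _); last lia.
by case: (eqVneq r i) => //= ne; apply: I1; lia.
Qed.

Lemma setupP s bits (cell : nat -> nat) (a : nat -> nat -> bool) :
  vr s 0 = n -> vr s 1 = k -> vr s 2 = eta ->
  bits = [seq cell y | y <- iota 3 (W - 3)] ->
  (forall y, W <= y < cap -> inp y = cell y) ->
  (forall i j, i < n -> j < n -> cell (3 + (i * n + j)) = a i j) ->
  let s' := run (Setup W bits) s in
  [/\ binv n k eta s' a 0, vr s' 3 = 0 & vr s' 4 = 1].
Proof.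
move=> e0 e1 e2 eb hI ha s'; rewrite {}/s' /Setup run_seq.
have F1 := frame_run W cap inp (Puts 3 bits) s.
have sz : size bits = W - 3 by rewrite eb size_map size_iota.
have P1 y : 3 <= y < W -> ar (run (Puts 3 bits) s) 4 0 y = cell y.
  move=> hy; rewrite putsP; [|lia|lia]; rewrite sz (_ : _ && _); last lia.
  by rewrite eb (nth_map 0) ?size_iota ?nth_iota; [congr cell; lia|lia|lia].
set s1 := run _ s in F1 P1 *.
have v1 x : vr s1 x = vr s x by rewrite (proj1 F1) // wvars_puts.
have L2 := loadP (etrans (v1 0) e0) P1 hI.
have F2 := frame_run W cap inp (LoadMatrix W) s1.
rewrite run_seq; set s2 := run _ s1 in F2 L2 *.
have e12 : vr s2 1 = k by frv F2 1; rewrite v1.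
have C3 := clearP e12.
have F3 := frame_run W cap inp Clear s2.
rewrite run_seq; set s3 := run _ s2 in F3 C3 *.
split=> //; split.
- by rewrite /=; frv F3 0; frv F2 0; rewrite v1.
- by rewrite /=; frv F3 1.
- by rewrite /=; frv F3 2; frv F2 2; rewrite v1.
- by move=> i j li lj; rewrite /=; fra F3 0; rewrite L2 // ha.
- by move=> r lr; rewrite /= C3 // /dig div0n mod0n.
Qed.

End SetupCorrect.

(** Makes one time bound valid for all the branches, which differ in the remembered bits but not in
    their number. *)
Lemma tc_puts NA cap c bits bits' : size bits = size bits' ->
  tc NA cap (Puts c bits) = tc NA cap (Puts c bits').
Proof.
by elim: bits bits' c => [|b bits IH] [|b' bits'] c //= [] /IH ->.
Qed.

Lemma digs_surj k ds : size ds = k -> all (fun d => d < 4) ds ->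
  exists2 v, v < 4 ^ k & digs k v = ds.
Proof.
elim: ds k => [|d ds IH] [|k] //=; first by exists 0.
move=> [sz] /andP[d4 al]; have [v lv ev] := IH k sz al.
exists (v * 4 + d); first by rewrite expnS; lia.
rewrite /digs /mkseq /= /dig expn0 divn1; congr (_ :: _).
  by rewrite modnMDl modn_small.
rewrite -[iota 1 k]/(iota (1 + 0) k) iotaDl -map_comp -ev; apply: eq_map => r /=.
by rewrite /dig add1n expnS divnMA divnMDl // [d %/ 4]divn_small // addn0.
Qed.

Lemma digs_lt k v : all (fun d => d < 4) (digs k v).
Proof. by apply/allP => d /mapP[r _ ->]; rewrite ltn_mod. Qed.

(** Variables 0 to 23 and arrays 0 to 4 are in use. The value 64 of [nW] leaves room for the deepest
    nesting of temporaries, which [wf_body] confirms by computation. *)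
Definition nV := 24.
Definition nA := 5.
Definition nW := 64.

(** Computes [cap] as [nW + 3 + n * n + k] by counting: the arrays must start beyond the end of the
    matrix at [3 + n * n], and [cap] must be at least [n + k + 2]. *)
Definition CapProg : prog :=
  Seq (Const nV (nW + 3))
  (Seq (Copy nV.+1 1) (Seq (Rep nV.+1 nV.+3 (Succs nV 1))
  (Seq (Copy nV.+1 0) (Rep nV.+1 nV.+3
     (Seq (Copy nV.+2 0) (Rep nV.+2 nV.+3 (Succs nV 1))))))).

Lemma runs_capProg m n k : m 0 = n -> m 1 = k ->
  runs CapProg m (5 + k * 5 + n * (n * 5 + 5))
    (fun m' => m' nV = nW + 3 + n * n + k /\
       forall y, (y < nV) || (nV.+3 < y) -> m' y = m y).
Proof.
move=> e0 e1.
apply: (runs_weaken (T := 1 + (1 + ((k * 5).+1 + (1 + (n * (1 + (n * 5).+1 + 3)).+1)))));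
  [|lia|by move=> ? h; exact: h].
apply: runs_seq; apply: runs_Const; apply: runs_seq; apply: runs_Copy.
apply: runs_seq.
apply: runs_weaken (runs_addloop (N := k) _ _ _ _ _) _ _ => //.
move=> m1 [m1v m1o].
apply: runs_seq; apply: runs_Copy.
have n0 : m1 0 = n by rewrite m1o.
pose I i (m' : memory) := m' nV = nW + 3 + k + i * n /\
  forall y, (y < nV) || (nV.+3 < y) -> m' y = m y.
apply: runs_weaken (runs_rep (T := 1 + (n * 5).+1) (N := n) (I := I) _ _ _ _) _ _ => //.
- split; first by rewrite updNE // m1v /upd /=; lia.
  by move=> y hy; rewrite updNE ?m1o ?updNE //; rewrite /nV in hy *; lia.
- move=> i m2 li m2c [I1 I2].
  apply: runs_seq; apply: runs_Copy.
  apply: runs_weaken (runs_addloop (N := n) _ _ _ _ _) _ _ => //.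
    by rewrite updE I2.
  move=> m3 [m3v m3o]; split; first by rewrite m3o.
  split; first by rewrite !updNE // m3v updNE // I1; lia.
  by move=> y hy; rewrite !updNE ?m3o ?updNE ?I2 //; rewrite /nV in hy *; lia.
- by move=> m2 [_ [I1 I2]]; split=> //; rewrite I1; lia.
Qed.

Definition Main (bits : seq nat) : prog :=
  Seq CapProg (Seq (cc nV nA nW nV.+1 (Setup nW bits))
    (Seq (While 4 (cc nV nA nW nV.+1 Body)) (Copy 0 3))).

Definition Algorithm : prog := Branch (nW - 3) 3 [::] Main.

Lemma wf_body : wfc nV nA nW nV.+1 Body.
Proof. by []. Qed.

Lemma wf_setup bits : wfc nV nA nW nV.+1 (Setup nW bits).
Proof.
have -> : wfc nV nA nW nV.+1 (Setup nW bits) = wfc nV nA nW nV.+1 (Puts 3 bits).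
  by rewrite /= andbT.
by elim: bits 3 => //= b bits IH c; rewrite IH.
Qed.

Lemma encode_mat n (E : {set {set 'I_n}}) k eta i j : i < n -> j < n ->
  encode E k eta (3 + (i * n + j)) = mat E i j.
Proof.
move=> li lj; rewrite /encode /=; congr nat_of_bool.
apply/existsP/existsP => [] [x /existsP[y h]]; exists x; apply/existsP; exists y;
  move: h.
  case/andP=> /eqP e ->; rewrite andbT.
  have {}e : i * n + j = x * n + y by lia.
  have n0 : 0 < n by lia.
  have := congr1 (fun u => u %/ n) e; have := congr1 (fun u => u %% n) e.
  rewrite !divnMDl // !modnMDl !modn_small // !divn_small // !addn0 => -> ->.
  by rewrite !eqxx.
by case/and3P=> /eqP -> /eqP -> ->; rewrite eqxx.
Qed.

Lemma encode_le1 n (E : {set {set 'I_n}}) k eta y : 3 <= y -> encode E k eta y <= 1.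
Proof. by case: y => [|[|[|y]]] // _; rewrite /encode /=; case: existsP. Qed.

Lemma runs_main n (E : {set {set 'I_n}}) k eta bits : E \subset pairs 'I_n ->
  bits = [seq encode E k eta y | y <- iota 3 (nW - 3)] ->
  let cap := nW + 3 + n * n + k in
  runs (Main bits) (encode E k eta)
    (5 + k * 5 + n * (n * 5 + 5) + (tc nA cap (Setup nW bits) +
      ((4 ^ k * (tc nA cap Body).+1).+1 + 1)))
    (fun m => accepts m <-> balanced_cluster_editing E k eta).
Proof.
move=> sE eb cap; set m0 := encode E k eta in eb *.
have ga := good_mat sE; set a := mat E in ga.
have capP : nW + 3 + n * n + k <= cap by [].
have capP' : n + k + 2 <= cap by rewrite /cap /nW; nia.
have NW : nV < nW by [].
have Wc : nW <= cap by rewrite /cap; lia.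
apply: runs_seq; apply: runs_weaken (runs_capProg (n := n) (k := k) _ _) _ _ => //.
move=> m1 [m1c m1o].
(* The store is read off the memory: variables and arrays start with whatever their cells hold. *)
pose s1 := Store m1 (fun b i j => m1 (cap + (i * cap.+1 + j) * nA + b)).
have r1 : represents nV nA nW cap m0 s1 m1.
  split=> // y hy; rewrite m1o //; rewrite /nW /nV in hy *; lia.
have [B0 a0 g0] := @setupP nW cap m0 n k eta capP isT s1 bits m0 a
  (m1o 0 isT) (m1o 1 isT) (m1o 2 isT) eb (fun y _ => erefl) (encode_mat E k eta).
apply: runs_seq.
apply: runs_weaken (runs_cc NW Wc _ (wf_setup bits) r1) _ _ => //.
move=> m2 [r2 _].
(* The answer variable after [v] rounds: whether one of the first [v] strings was accepted. *)
pose acc v := has (fun u => acceptb n k eta cap (digs k u) a) (iota 0 v).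
pose I v (m : memory) := exists s, [/\ represents nV nA nW cap m0 s m,
  binv n k eta s a v, vr s 3 = acc v & vr s 4 = (v != 4 ^ k)].
apply: runs_seq.
apply: runs_weaken
  (runs_while_iter (N := 4 ^ k) (T := tc nA cap Body) (I := I) _ _ _) _ _ => //.
- exists (run nW cap m0 (Setup nW bits) s1); split=> //.
  by rewrite g0 eq_sym expn_eq0.
- move=> v m lv [s [rs Bs as_ gs]].
  have gv : vr s 4 = 1 by rewrite gs neq_ltn lv.
  split; first by case: rs => h _ _ _; rewrite h // gv.
  apply: runs_weaken (runs_cc NW Wc _ wf_body rs) _ _ => //.
  move=> m' [rs' _]; exists (run nW cap m0 Body s).
  have [B1 a1 g1] := @bodyP nW cap m0 n k eta capP' s a v (acc v) ga lv Bs as_ gv.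
  split=> //; rewrite a1 /acc -[v.+1]addn1 iotaD has_cat /= orbF add0n //.
- by move=> m [s [[h _ _ _] _ _ gs]]; rewrite h // gs eqxx.
move=> m3 [s3 [[h3 _ _ _] _ a3 _]]; apply: runs_Copy.
rewrite /accepts updE h3 // a3 eqb0 negbK bce_labelling // -(acceptb_iff eta capP' ga).
split=> [/hasP[v _ hv]|[ds [sz al ok]]].
  by exists (digs k v); rewrite size_mkseq digs_lt.
have [v lv ev] := digs_surj sz al.
by apply/hasP; exists v; rewrite ?ev // mem_iota.
Qed.

Lemma algorithm_correct : exists C,
  forall n (E : {set {set 'I_n}}) k eta, E \subset pairs 'I_n ->
  exists t m, [/\ exec Algorithm (encode E k eta) t m,
    accepts m <-> balanced_cluster_editing E k eta &
    t <= 4 ^ k * pbnd C (nW + 3 + n * n + k)].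
Proof.
have [C1 h1] := tc_poly nA (Setup nW (nseq (nW - 3) 0)).
have [C2 h2] := tc_poly nA Body.
exists (80 + C1 + C2) => n E k eta sE; set cap := nW + 3 + n * n + k.
have [|t [m [ex le Q]]] := @runs_branch (nW - 3) 3 [::] Main (encode E k eta) _ _ _
   (runs_main sE erefl).
  by move=> y /andP[hy _]; apply: encode_le1.
exists t, m; split=> //; apply: leq_trans le _.
have p0 : 0 < 4 ^ k by rewrite expn_gt0.
have {}h2 := h2 cap; have {}h1 := h1 cap.
(* The constant 80 is a crude choice covering the steps outside the two compiled programs. *)
have A : 5 + k * 5 + n * (n * 5 + 5) + nW + 2 <= pbnd 80 cap.
  apply: (@leq_trans (80 * cap.+1)); first by rewrite /cap /nW; nia.
  by rewrite leq_mul2l /= -{1}[cap.+1]expn1 leq_pexp2l.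
have -> : tc nA cap (Setup nW [seq encode E k eta y | y <- iota 3 (nW - 3)]) =
    tc nA cap (Setup nW (nseq (nW - 3) 0)).
  have tcS b : tc nA cap (Setup nW b) = tc nA cap (Puts 3 b) +
      tc nA cap (LoadMatrix nW;; Clear;; 3 ::= EC 0;; 4 ::= EC 1) by [].
  by rewrite !tcS (@tc_puts _ _ _ _ (nseq (nW - 3) 0)).
have B := pbnd_add (pbnd_add A h1) h2.
apply: leq_trans (leq_mul (leqnn (4 ^ k)) B).
rewrite -/cap.
move: (tc nA cap _) (tc nA cap _) (5 + _ + _) (4 ^ k) p0 => b s a x x0.
have h : x + (a + nW + 2 + s) <= x * (a + nW + 2 + s) + 1 by nia.
by rewrite mulnS [_ * (_ + b)]mulnDr; rewrite /nW in h *; lia.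
Qed.

(** The base [n * n + k + 68] is at most [70 * (k + 1) * (M * M)] with [M] the maximum of [n] and 1,
    which separates [k] from [n]. The coefficient is raised to [A.+1] to have a logarithm that is
    non-negative. *)
Lemma algorithm_time : exists A C, forall n (E : {set {set 'I_n}}) k eta,
  E \subset pairs 'I_n ->
  exists t m, [/\ exec Algorithm (encode E k eta) t m,
    accepts m <-> balanced_cluster_editing E k eta &
    t <= 4 ^ k * (A.+1 * k.+1 ^ C) * maxn n 1 ^ (2 * C)].
Proof.
have [C HC] := algorithm_correct; exists (C * (nW + 6) ^ C), C.
move=> n E k eta sE; have [t [m [ex Q le]]] := HC n E k eta sE.
exists t, m; split=> //; apply: leq_trans le _.
rewrite -mulnA leq_mul2l expn_eq0 /=; set M := maxn n 1.
have le1 : (nW + 3 + n * n + k).+1 <= (nW + 6) * k.+1 * (M * M).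
  have nM : n * n <= M * M by apply: leq_mul; apply: leq_maxl.
  have M1 : 0 < M * M by rewrite muln_gt0 andbb leq_maxr.
  have kM : k.+1 <= k.+1 * (M * M) by rewrite leq_pmulr.
  have Mk : M * M <= k.+1 * (M * M) by rewrite leq_pmull.
  by rewrite -mulnA mulnDl /nW; lia.
have le2 : (nW + 3 + n * n + k).+1 ^ C <= ((nW + 6) * k.+1 * (M * M)) ^ C.
  by case: (posnP C) => [->|C0] //; rewrite leq_exp2r.
rewrite /pbnd; apply: leq_trans (leq_mul (leqnn C) le2) _.
have MM : (M * M) ^ C = M ^ (2 * C) by rewrite mulnn expnM.
rewrite expnMn MM expnMn !mulnA.
by do 2!(apply: leq_mul => //); apply: leqnSn.
Qed.

(** * The main theorem *)

From mathcomp Require Import ring lra.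
From mathcomp Require Import all_classical all_reals all_analysis.
Import Order.TTheory GRing.Theory Num.Theory.
Import numFieldNormedType.Exports.
Local Open Scope classical_set_scope.
Local Open Scope ring_scope.

(** The tangent bound [ln (1 + y) <= y] at [1 + y = d * x]. The slope [d] may be as small as
    desired, which makes the logarithm sublinear. *)
Lemma ln_le_linear (R : realType) (d x : R) : 0 < d -> 0 < x ->
  ln x <= d * x - ln d.
Proof.
move=> d0 x0; have dx0 : 0 < d * x by rewrite mulr_gt0.
have : ln (1 + (d * x - 1)) <= d * x - 1 by apply: le_ln1Dx; lra.
rewrite addrC subrK lnM ?posrE //; lra.
Qed.

Lemma ln_poly_littleo (R : realType) (a : R) (C : nat) : 0 <= a ->
  (fun k : nat => a + (ln (k.+1%:R : R)) *+ C) =o_\oo (fun k : nat => k%:R : R).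
Proof.
move=> a0; apply/eqoP => e e0.
(* Chosen so that [C * d] is at most [e / 2]; the other half of [e * k] absorbs the constant [K] as
   soon as [k] reaches [2 * K / e]. *)
pose d := e / (2 * (C%:R + 1)).
have C0 : 0 <= C%:R :> R by apply: ler0n.
have d0 : 0 < d by rewrite divr_gt0 //; lra.
have dC : C%:R * d <= e / 2.
  rewrite /d mulrA ler_pdivrMr; last lra.
  rewrite (_ : e / 2 * (2 * (C%:R + 1)) = C%:R * e + e); last by field.
  by lra.
pose K := a + C%:R * d - C%:R * ln d.
near=> k.
have hk : K * 2 / e <= k%:R by near: k; apply: nbhs_infty_ger.
have hK : K <= e / 2 * k%:R.
  move: hk; rewrite ler_pdivrMr // => hk; lra.
have l0 : 0 <= ln (k.+1%:R : R) by apply: ln_ge0; rewrite ler1n.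
have := @ln_le_linear R d k.+1%:R d0 _; rewrite ltr0n => /(_ isT) hl.
have k0 : 0 <= k%:R :> R by apply: ler0n.
suff : `|a + ln (k.+1%:R : R) *+ C| <= e * `|k%:R : R| by [].
rewrite normr_nat ger0_norm; last by rewrite addr_ge0 // mulrn_wge0.
rewrite -[ln _ *+ C]mulr_natr.
have h1 : ln (k.+1%:R : R) * C%:R <= (d * k.+1%:R - ln d) * C%:R by apply: ler_wpM2r.
have h2 : C%:R * d * k%:R <= e / 2 * k%:R by apply: ler_wpM2r.
move: h1 hK h2; rewrite /K -natr1; lra.
Unshelve. all: by end_near.
Qed.

(* [maxn n 1] is [n] except for the graph without vertices, where [n ^+ c] would
   allow no step at all.  Constant factors are absorbed by [g]. *)
Theorem mainTheorem11 (R : realType) :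
  exists (P : prog) (g : nat -> R) (c : nat),
    g =o_\oo (fun k : nat => k%:R : R) /\
    forall (n : nat) (E : {set {set 'I_n}}) (k eta : nat),
      E \subset pairs 'I_n ->
      exists (t : nat) (m : memory),
        [/\ exec P (encode E k eta) t m,
            accepts m <-> balanced_cluster_editing E k eta
          & t%:R <= 4 `^ (k%:R + g k) * (maxn n 1)%:R ^+ c].
Proof.
have [A [C H]] := algorithm_time.
have D0 : 0 < ln (4 : R) by apply: ln_gt0; lra.
have A1 : 1 <= A.+1%:R :> R by rewrite ler1n.
(* The logarithm to base 4 of [(A + 1) * (k + 1) ^ C], so that [4 ^ g k] is exactly this factor. *)
pose g k : R := (ln (A.+1%:R : R) + ln (k.+1%:R : R) *+ C) / ln 4.
exists Algorithm, g, (2 * C)%N; split.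
  have -> : g = (fun k => ln (A.+1%:R) / ln 4 + (ln (k.+1%:R : R) *+ C) / ln 4).
    by apply: funext => k; rewrite /g mulrDl.
  apply/eqoP => e e0.
  (* Rescaling the tolerance by [ln 4] accounts for the division by [ln 4] in [g]. *)
  have /eqoP/(_ (e * ln 4)) := @ln_poly_littleo R _ C (ln_ge0 A1).
  rewrite mulr_gt0 // => /(_ isT); apply: filterS => k hk.
  rewrite -mulrDl normrM [X in _ * X]gtr0_norm ?invr_gt0 //.
  by rewrite ler_pdivrMr // mulrAC.
move=> n E k eta sE; have [t [m [ex Q le]]] := H n E k eta sE.
exists t, m; split=> //.
have -> : 4 `^ (k%:R + g k) = (4 ^ k * (A.+1 * k.+1 ^ C))%:R.
  rewrite powRD; last by rewrite pnatr_eq0 implybT.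
  rewrite powR_mulrn // /powR pnatr_eq0 /= /g divfK ?gt_eqF //.
  rewrite -lnXn ?ltr0n // -lnM ?posrE ?exprn_gt0 ?ltr0n //.
  rewrite lnK ?posrE ?mulr_gt0 ?exprn_gt0 ?ltr0n //.
  by rewrite !natrM !natrX.
by rewrite -natrX -natrM ler_nat.
Qed.
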